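(* For every positive integer $n$ there is a unique real number $d\le n$ with the following three properties. (1) There exists a compact set in $\mathbb{R}^n$ of Hausdorff dimension $d$ that contains a unit line segment in every direction. (2) There exists a closed set in $\mathbb{R}^n$ of Hausdorff dimension $d$ that contains a line in every direction. (3) Let $D\subset\mathbb{RP}^{n-1}$ be a set of directions of Hausdorff dimension $n-1$, and let $S$ be an arbitrary subset of $\mathbb{R}^n$ that contains a line segment in every direction of $D$. Then $S$ has Hausdorff dimension at least $d$.
   Context: Directions in $\mathbb{R}^n$ are elements of the real projective space $\mathbb{RP}^{n-1}$, equipped with a natural metric (e.g. the angle metric). Line segments are non-degenerate (of positive length); a unit line segment has length $1$; a line means a full (infinite) straight line. *)

(* Defs.v *)
From HB Require Import structures.
From mathcomp Require Import all_boot all_order all_algebra.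
From mathcomp Require Import all_classical all_reals all_analysis.

Set Implicit Arguments.
Unset Strict Implicit.
Unset Printing Implicit Defensive.

Import Order.TTheory GRing.Theory Num.Theory.

Local Open Scope classical_set_scope.
Local Open Scope ring_scope.

(** Hausdorff measure and dimension with respect to an explicit distance.
    The distance is a parameter because the canonical metric of 'rV[R]_n is the
    sup metric, while the Euclidean one is meant here. *)
Section Hausdorff.
Context {R : realType} {T : Type}.
Variable dist : T -> T -> R.
Local Open Scope ereal_scope.

(* diam set0 = -oo, as a supremum over the empty set. *)
Definition diam (U : set T) : \bar R :=
  ereal_sup [set (dist p.1 p.2)%:E | p in U `*` U].

(* The empty set costs nothing even for s = 0, whereas 0 `^ 0 = 1 for a point:
   with this convention the 0-dimensional measure is the counting measure. *)
Definition diam_pow (s : R) (U : set T) : \bar R :=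
  if U == set0 then 0 else diam U `^ s.

Definition hausdorff_premeasure (s delta : R) (A : set T) : \bar R :=
  ereal_inf [set \sum_(0 <= i <oo) diam_pow s (U i) | U in
    [set U : (set T)^nat |
       A `<=` \bigcup_i U i /\ forall i, diam (U i) <= delta%:E]].

(* The premeasure is nonincreasing in delta, so the supremum is the limit as
   delta tends to 0. *)
Definition hausdorff_measure (s : R) (A : set T) : \bar R :=
  ereal_sup [set hausdorff_premeasure s delta A | delta in
    [set delta : R | (0 < delta)%R]].

(* A nonempty set has dimension at least 0; the empty set has dimension -oo.
   The latter matters for subsets of the one-point space RP^0, where "dimension
   0" must mean "nonempty". *)
Definition hausdorff_dim (A : set T) : \bar R :=
  ereal_sup [set s%:E | s in
    [set s : R | (0 <= s)%R /\ 0 < hausdorff_measure s A]].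

Lemma hausdorff_dim_set0 : hausdorff_dim set0 = -oo.
Proof.
apply/ereal_sup_ninfty => x [s [s0]] /[swap] _.
rewrite ltNge => /negP[]; apply: ge_ereal_sup => _ [delta d0 <-].
apply: ereal_inf_lbound; exists (fun=> set0).
  split=> // i; rewrite /diam set0X image_set0 ereal_sup0; exact: leNye.
by rewrite eseries0// => i _ _; rewrite /diam_pow eqxx.
Qed.

End Hausdorff.

Section Euclidean.
Context {R : realType} {n : nat}.
Implicit Types (u v a b : 'rV[R]_n).

Definition dot u v : R := (u *m v^T) 0 0.

Definition eucl_norm u : R := Num.sqrt (dot u u).

Definition eucl_dist u v : R := eucl_norm (u - v).

Definition segment a b : set 'rV[R]_n :=
  [set a + t *: (b - a) | t in [set t : R | 0 <= t <= 1]].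

End Euclidean.

(** Real projective space RP^(n-1): the lines through the origin of R^n. *)
Definition projective (R : realType) (n : nat) : Type :=
  {L : {vspace 'rV[R]_n} | \dim L == 1%N}.

Section Directions.
Context {R : realType} {n : nat}.
Implicit Types (L M : projective R n) (S : set 'rV[R]_n).

(* The angle in [0, pi/2] between two lines; vpick chooses a nonzero vector of
   each, and angleE shows that the choice is irrelevant. *)
Definition angle L M : R :=
  let u := vpick (val L) in let v := vpick (val M) in
  acos (`|dot u v| / (eucl_norm u * eucl_norm v)).

Definition line_through (a : 'rV[R]_n) L : set 'rV[R]_n :=
  [set x | x - a \in val L].

Definition contains_segment S L : Prop :=
  exists a b, [/\ a != b, b - a \in val L & segment a b `<=` S].

Definition contains_unit_segment S L : Prop :=
  exists a b, [/\ eucl_dist a b = 1, b - a \in val L & segment a b `<=` S].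

Definition contains_line S L : Prop := exists a, line_through a L `<=` S.

Lemma dotZl (c : R) (u v : 'rV[R]_n) : dot (c *: u) v = c * dot u v.
Proof. by rewrite /dot -scalemxAl mxE. Qed.

Lemma dotZr (c : R) (u v : 'rV[R]_n) : dot u (c *: v) = c * dot u v.
Proof. by rewrite /dot linearZ -scalemxAr mxE. Qed.

Lemma eucl_normZ (c : R) (u : 'rV[R]_n) : eucl_norm (c *: u) = `|c| * eucl_norm u.
Proof.
by rewrite /eucl_norm dotZl dotZr mulrA -expr2 sqrtrM ?sqr_ge0// sqrtr_sqr.
Qed.

Lemma projective_pick L (u : 'rV[R]_n) : u \in val L -> u != 0 ->
  exists2 c, c != 0 & vpick (val L) = c *: u.
Proof.
move=> uL u0; have /eqP dL := valP L.
have LE : <[u]>%VS = val L.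
  by apply/eqP; rewrite eqEdim -memvE uL dL dim_vline u0.
have /vlineP[c cE] : vpick (val L) \in <[u]>%VS by rewrite LE memv_pick.
exists c => //; apply/eqP => c0; have : val L == 0%VS.
  by rewrite -vpick0 cE c0 scale0r.
by move=> /eqP L0; move: dL; rewrite L0 dimv0.
Qed.

Lemma angleE L M (u v : 'rV[R]_n) :
  u \in val L -> u != 0 -> v \in val M -> v != 0 ->
  angle L M = acos (`|dot u v| / (eucl_norm u * eucl_norm v)).
Proof.
move=> uL u0 vM v0; rewrite /angle.
have [c c0 ->] := projective_pick uL u0; have [e e0 ->] := projective_pick vM v0.
rewrite dotZl dotZr !eucl_normZ !normrM mulrACA mulrA -mulf_div.
by rewrite divff ?mul1r// mulf_neq0 ?normr_eq0.
Qed.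

End Directions.

(* Main.v *)
Require Import Defs.
From mathcomp Require Import all_boot all_order all_algebra.
From mathcomp Require Import all_classical all_reals all_analysis.
From mathcomp Require Import zify ring lra.

Set Implicit Arguments.
Unset Strict Implicit.
Unset Printing Implicit Defensive.

Import Order.TTheory GRing.Theory Num.Theory.
Import numFieldNormedType.Exports.

Local Open Scope classical_set_scope.

(** Write n = m + 1.  The number d is the infimum of the exponents s > 0 for
    which some set of zero s-dimensional measure contains a segment in every
    direction of some set of directions of dimension m ([admissible]).
    Property (3) is then immediate, and since the whole projective space has
    dimension m ([hausdorff_dim_projective]), a set with a segment in every
    direction has dimension at least d; this also gives uniqueness.  What has
    to be shown is that the infimum is attained by a closed set with full
    lines: from sets which are only nearly optimal, and which have segments
    only in the directions of a possibly null set D, one must build a closed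
    set of dimension at most d with a line in every direction.  The compact set
    is a bounded piece of it.

    From D to all directions ([thin_tubes]).  In coordinates (x, t), with x in
    R^m, the line (a + t v, t) has slope v, and the shear
    (x, t) |-> (x + t e, t) adds e to the slope.  If E is a set of translations
    such that D + E contains all slopes, then the union of the sheared copies
    of S over e in E has segments in all directions; and if E has covering
    numbers at most C rho^-tau, the copies of a ball of radius rho are covered
    by that many balls of comparable radius, so that the dimension increases by
    at most tau.  The set S is first replaced by a neighbourhood, a union of
    balls of total cost epsilon, and D by the slopes Y_j of the segments which
    lie, with a margin, in the first j balls; all is well if C depends on D
    but not on epsilon.

    The translations ([sumset_cover]).  Use grids of rapidly decreasing mesh,
    each about the square of the previous one.  Call a cell bushy if many of
    its children are bushy.  If the root is not bushy for any Y_j, then D is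
    covered by few cells at each level, so has small content at an exponent
    sigma close to m ([bushy_or_sparse]), which is false.  If the root is bushy
    for Y_j, then at each level one set of shifts, of size about the inverse of
    the density of bushy children up to a logarithm, moves every child of every
    bushy cell onto a bushy child ([hitting_set]); E is the sum of these sets
    over all levels.  As the scales decrease so fast, the logarithm and the
    loss at intermediate scales are absorbed in tau.

    The closed set ([line_set]).  Given a closed set which contains a tube about
    some line of each slope, cut the slopes into small cells, and inside the
    tube attached to each cell put an affine copy, compressed in the x
    direction, of a set of thin tubes of tiny cost ([refine_tubes]).
    Iterating, with heights going to infinity, gives a nested sequence, whose
    intersection is null for every exponent above d and contains a line of
    each slope by compactness.  Finitely many coordinate charts then give all
    directions. *)

(** * Hitting sets, and trees with many surviving children *)

Lemma leq_sum_size (I : eqType) (s : seq I) (F : I -> nat) n :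
  (forall i, i \in s -> (F i <= n)%N) -> (\sum_(i <- s) F i <= size s * n)%N.
Proof.
elim: s => [|i s IH] Fn; first by rewrite big_nil.
rewrite big_cons /= mulSn leq_add ?Fn ?mem_head//.
by apply: IH => k ks; apply: Fn; rewrite inE ks orbT.
Qed.

Lemma size_leq_sum (I : eqType) (s : seq I) (F : I -> nat) n :
  (forall i, i \in s -> (n <= F i)%N) -> (size s * n <= \sum_(i <- s) F i)%N.
Proof.
elim: s => [|i s IH] Fn; first by rewrite big_nil.
rewrite big_cons /= mulSn leq_add ?Fn ?mem_head//.
by apply: IH => k ks; apply: Fn; rewrite inE ks orbT.
Qed.

Lemma sub_in_count (I : eqType) (p q : pred I) (s : seq I) :
  {in s, subpred p q} -> (count p s <= count q s)%N.
Proof.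
elim: s => //= i s IH pq; rewrite leq_add//.
  by case pi: (p i) => //; rewrite pq ?mem_head.
by apply: IH => k ks; apply: pq; rewrite inE ks orbT.
Qed.

Section Hitting.
Variables (I V : eqType) (P : I -> pred V) (U : seq V) (N a : nat).
Hypotheses (N_gt0 : (0 < N)%N) (sizeU : (size U <= a * N)%N).

(** Double counting of the pairs of an element of U and a member of the family
    that it hits: some element hits at least the average number of members. *)
Lemma exists_frequent_hit (fam : seq I) : (0 < size fam)%N ->
  (forall i, i \in fam -> (N <= count (P i) U)%N) ->
  exists2 u, u \in U & (size fam <= count (P^~ u) fam * a)%N.
Proof.
move=> fam0 famN.
have dbl : (\sum_(u <- U) count (P^~ u) fam = \sum_(i <- fam) count (P i) U)%N.
  under eq_bigr do rewrite -sum1_count big_mkcond.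
  rewrite exchange_big /=; apply: eq_bigr => i _.
  by rewrite -sum1_count [RHS]big_mkcond.
apply: contrapT => H.
have small u : u \in U -> (count (P^~ u) fam * a + 1 <= size fam)%N.
  by move=> uU; rewrite addn1 ltnNge; apply/negP => h; apply: H; exists u.
have := size_leq_sum famN; rewrite -dbl => big.
have U0 : (0 < size U)%N.
  by case: (U) big => //; rewrite big_nil; move: N_gt0 fam0; nia.
have := leq_sum_size small.
rewrite big_split /= sum1_size -big_distrl /=.
move: big U0 sizeU fam0 N_gt0.
set S := (X in (_ <= X)%N) => *; nia.
Qed.

(** Repeatedly adding the most frequent element multiplies the number of members
    not yet hit by at most 1 - 1/a. *)
Lemma greedy_hitting (fam : seq I) t :
  (forall i, i \in fam -> (N <= count (P i) U)%N) ->
  exists E : seq V, [/\ (size E <= t)%N, {subset E <= U} &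
    (count (fun i => ~~ has (P i) E) fam * a ^ t <= size fam * a.-1 ^ t)%N].
Proof.
move=> famN; elim: t => [|t [E [sE EU IH]]].
  by exists [::]; split=> //; rewrite !expn0 !muln1 count_size.
set fam' := [seq i <- fam | ~~ has (P i) E].
have [f0|f0] := posnP (size fam').
  exists E; split=> //; first exact: leqW.
  by rewrite -size_filter -/fam' f0.
have [i|u uU hu] := @exists_frequent_hit fam' f0.
  by rewrite mem_filter => /andP[_]; exact: famN.
exists (u :: E); split=> //; first by move=> v; rewrite inE => /predU1P[->|/EU].
have -> : count (fun i => ~~ has (P i) (u :: E)) fam
    = (size fam' - count (P^~ u) fam')%N.
  rewrite -(count_predC (P^~ u) fam') addKn /fam' count_filter.
  by apply: eq_count => i /=; rewrite negb_or.
have -> : (size fam * a.-1 ^ t.+1 = (size fam * a.-1 ^ t) * a.-1)%N.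
  by rewrite expnSr mulnA.
rewrite expnSr mulnCA mulnA (mulnC (a ^ t)).
apply: (@leq_trans ((size fam' * a.-1) * a ^ t)%N).
  by rewrite -mulnA (mulnC (a ^ t)) mulnA leq_mul2r; apply/orP; right; nia.
rewrite mulnAC leq_mul2r; apply/orP; right.
by rewrite /fam' size_filter.
Qed.

Lemma pow_pred_half b : (0 < b)%N -> (2 * b.-1 ^ b <= b ^ b)%N.
Proof.
case: b => // b _ /=.
rewrite -[b.+1 in leqRHS](addn1 b).
have: forall k, (b ^ k + k * b ^ k.-1 <= (b + 1) ^ k)%N.
  elim=> [|k IH]; first by [].
  rewrite !expnS /=; case: k IH => [|k] IH; first by rewrite !expn0; lia.
  move: IH; rewrite /= !expnS; nia.
by move=> /(_ b.+1) /=; rewrite addn1 expnS; lia.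
Qed.

(** Since (1 - 1/a)^a <= 1/2, the greedy choice halves the family every a steps.
    The size is thus only logarithmic in the number of members. *)
Lemma hitting_set (fam : seq I) e :
  (0 < a)%N -> (size fam < 2 ^ e)%N ->
  (forall i, i \in fam -> (N <= count (P i) U)%N) ->
  exists E : seq V, [/\ (size E <= a * e)%N, {subset E <= U} &
    forall i, i \in fam -> has (P i) E].
Proof.
move=> a0 fe famN; have [E [sE EU h]] := greedy_hitting (a * e) famN.
exists E; split=> // i ifam; apply/negPn/negP => nh.
have c0 : (0 < count (fun i => ~~ has (P i) E) fam)%N.
  by rewrite -has_count; apply/hasP; exists i.
have h2 : (2 ^ e * a.-1 ^ (a * e) <= a ^ (a * e))%N.
  rewrite !expnM -expnMn; case: (e) => // e'.
  by rewrite leq_exp2r // pow_pred_half.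
have p0 : (0 < a ^ (a * e))%N by rewrite expn_gt0 a0.
have h3 : (a ^ (a * e) <= size fam * a.-1 ^ (a * e))%N.
  by apply: leq_trans h; rewrite leq_pmull.
have : (size fam * a.-1 ^ (a * e) < 2 ^ e * a.-1 ^ (a * e))%N.
  rewrite ltn_pmul2r // lt0n; apply/eqP => z.
  by move: h3; rewrite z muln0 leqNgt p0.
by rewrite ltnNge (leq_trans h2 h3).
Qed.

End Hitting.

Section Tree.
Variables (T : Type) (V : eqType).
Variables (digs : nat -> seq V) (dig : seq V -> T -> V) (N : nat -> nat).

Fixpoint nodes k : seq (seq V) :=
  if k is k'.+1 then [seq rcons Q a | Q <- nodes k', a <- digs k'] else [:: [::]].

(** A cell of level k is encoded by its list of k digits, so that this is the cell
    of level k around x. *)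
Fixpoint prefix_of (x : T) k : seq V :=
  if k is k'.+1 then rcons (prefix_of x k') (dig (prefix_of x k') x) else [::].

(** Survival of a large subtree of depth h below Q: a combinatorial substitute for
    Q meeting A in a set of large content. *)
Fixpoint bushy (A : set T) h (Q : seq V) : Prop :=
  if h is h'.+1 then
    (N (size Q) <= count (fun a => `[< bushy A h' (rcons Q a) >]) (digs (size Q)))%N
  else exists2 x, A x & prefix_of x (size Q) = Q.

Lemma size_prefix_of x k : size (prefix_of x k) = k.
Proof. by elim: k => //= k IH; rewrite size_rcons IH. Qed.

Lemma take_prefix_of x j l : take j (prefix_of x (j + l)) = prefix_of x j.
Proof.
elim: l => [|l IH]; first by rewrite addn0 take_oversize// size_prefix_of.
by rewrite addnS /= -cats1 takel_cat ?IH// size_prefix_of leq_addr.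
Qed.

Lemma size_nodes k : size (nodes k) = (\prod_(i < k) size (digs i))%N.
Proof.
elim: k => [|k IH]; first by rewrite big_ord0.
by rewrite big_ord_recr /= size_allpairs IH.
Qed.

Lemma nodesS k Q a : Q \in nodes k -> a \in digs k -> rcons Q a \in nodes k.+1.
Proof. by move=> Qk ak; apply/allpairsP; exists (Q, a). Qed.

Lemma mem_nodes k Q : Q \in nodes k -> size Q = k.
Proof.
elim: k Q => [|k IH] Q; first by rewrite inE => /eqP ->.
by move=> /allpairsP[[Q' a] /= [/IH <- _ ->]]; rewrite size_rcons.
Qed.

Lemma prefix_of_nodes x :
  (forall k, dig (prefix_of x k) x \in digs k) -> forall k, prefix_of x k \in nodes k.
Proof. by move=> xd; elim=> [//|k IH]; apply: nodesS. Qed.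

Lemma bushyS_sub (A B : set T) h Q : A `<=` B -> bushy A h Q -> bushy B h Q.
Proof.
move=> AB; elim: h Q => [|h IH] Q /=; first by case=> x Ax e; exists x => //; exact: AB.
move=> h1; apply: (leq_trans h1); apply: sub_count => a /= /asboolP ha.
by apply/asboolP/IH.
Qed.

Hypothesis N_gt0 : forall k, (0 < N k)%N.

Lemma bushy_pred (A : set T) h Q : bushy A h.+1 Q -> bushy A h Q.
Proof.
elim: h Q => [|h IH] Q.
  move=> /= /(leq_trans (N_gt0 _)); rewrite -has_count => /hasP[a _ /asboolP].
  by rewrite size_rcons => -[x Ax /rcons_inj[<- _]]; exists x; rewrite ?size_prefix_of.
move=> h1; apply: (leq_trans h1); apply: sub_count => a /= /asboolP ha.
by apply/asboolP/IH.
Qed.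

Lemma finite_max_exists (s : seq V) (G : nat -> V -> Prop) :
  (forall i j a, (i <= j)%N -> G i a -> G j a) ->
  exists J, forall a, a \in s -> (exists j, G j a) -> G J a.
Proof.
move=> Gm; elim: s => [|a s [J IH]]; first by exists 0%N.
have [[j Gj]|nG] := pselect (exists j, G j a).
  exists (maxn j J) => b; rewrite inE => /predU1P[->|bs] e.
    by apply: Gm Gj; rewrite leq_maxl.
  by apply: (Gm J); [rewrite leq_maxr|exact: IH].
by exists J => b; rewrite inE => /predU1P[->//|bs]; exact: IH.
Qed.

Lemma size_select_children (c : seq V -> pred V) n k :
  (forall Q, Q \in nodes k -> (count (c Q) (digs k) <= n)%N) ->
  (size [seq rcons Q a | Q <- nodes k, a <- [seq a <- digs k | c Q a]]
     <= (\prod_(i < k) size (digs i)) * n)%N.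
Proof.
move=> cn; rewrite size_allpairs_dep -size_nodes sumnE big_map.
apply: leq_sum_size => Q /cn; by rewrite size_filter.
Qed.

(** Call Q good if it is bushy to every depth for some Y j.  A cell that is not
    good has at most N good children, for otherwise a large enough j would serve
    for N of them at once.  If the root is not good, the good children of cells
    that are not good are therefore few at each level.  A point of Y j which is
    in none of them has only bad ancestors; its ancestor at level j fails to be
    bushy for Y j at some depth, and so on the way down there is a first cell
    that is bushy to the remaining depth with a parent that is not; these cells
    are few too.  Starting at level j rather than at the root is what makes the
    sum over all j converge: level i only receives cells from j <= i. *)
Lemma bushy_or_sparse (Y : nat -> set T) :
  (forall i j, (i <= j)%N -> Y i `<=` Y j) ->
  (forall j x, Y j x -> forall k, dig (prefix_of x k) x \in digs k) ->
  (exists j, forall h, bushy (Y j) h [::]) \/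
  exists F : nat -> seq (seq V),
    [/\ forall i Q, Q \in F i -> size Q = i.+1,
        forall i, (size (F i) <= i.+2 * ((\prod_(l < i) size (digs l)) * N i))%N &
        forall j x, Y j x -> exists i, prefix_of x i.+1 \in F i].
Proof.
move=> Ym Yd.
pose G Q := exists j, forall h, bushy (Y j) h Q.
have [|nG] := pselect (G [::]); [by left|right].
have GN Q : ~ G Q -> (count (fun a => `[< G (rcons Q a) >]) (digs (size Q)) <= N (size Q))%N.
  move=> nGQ; rewrite leqNgt; apply/negP => /ltnW h; apply: nGQ.
  have [|J HJ] := @finite_max_exists (digs (size Q))
      (fun j a => forall h, bushy (Y j) h (rcons Q a)).
    by move=> i j a /Ym Yij H h'; apply: bushyS_sub (H h').
  have HS h' : bushy (Y J) h'.+1 Q.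
    apply: (leq_trans h); apply: sub_in_count => a ad /asboolP Ga.
    by apply/asboolP/HJ.
  by exists J => -[|h']; [apply: bushy_pred; exact: HS|exact: HS].
have /(_ _)/cid-/all_sig[H HP] : forall Qj : seq V * nat, exists h,
    ~ G Qj.1 -> ~ bushy (Y Qj.2) h Qj.1.
  move=> [Q j] /=; have [GQ|nGQ] := pselect (G Q); first by exists 0%N.
  by have /existsNP[h hh] : ~ forall h, bushy (Y j) h Q
    by [move=> h; apply: nGQ; exists j]; exists h.
pose fuel j Q := (H (take j Q, j) - (size Q - j))%N.
(* c1 selects the good children of cells that are not good; c2 j selects the
   cells where bushiness for Y j begins, when descending from level j with
   the depth at which the ancestor of that level fails. *)
pose c1 Q a := `[< ~ G Q /\ G (rcons Q a) >].
pose c2 j Q a := `[< [/\ (0 < fuel j Q)%N, ~ bushy (Y j) (fuel j Q) Q &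
  bushy (Y j) (fuel j Q).-1 (rcons Q a)] >].
pose sel c i := [seq rcons Q a | Q <- nodes i, a <- [seq a <- digs i | c Q a]].
exists (fun i => sel c1 i ++ flatten [seq sel (c2 j) i | j <- iota 0 i.+1]); split.
- have selS c i Q : Q \in sel c i -> size Q = i.+1.
    by move=> /allpairsPdep[Q' [a [/mem_nodes<- _ ->]]]; rewrite size_rcons.
  move=> i Q; rewrite mem_cat => /orP[/selS//|/flatten_mapP[j _ /selS//]].
- move=> i; rewrite size_cat mulSn leq_add//.
    apply: size_select_children => Q /mem_nodes <-.
    have [GQ|nGQ] := pselect (G Q).
      rewrite (eq_count (a2 := pred0)) ?count_pred0// => a /=.
      by apply/negbTE/asboolPn => -[].
    apply: leq_trans (GN _ nGQ); apply: sub_count => a /asboolP[_ ?]; exact/asboolP.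
  rewrite size_flatten sumnE /shape big_map -{2}(size_iota 0 i.+1) big_map.
  apply: leq_sum_size => j _; apply: size_select_children => Q /mem_nodes <-.
  have [[f0 nb]|nb] := pselect ((0 < fuel j Q)%N /\ ~ bushy (Y j) (fuel j Q) Q).
    move: (nb); rewrite -{1}(prednK f0) /= => /negP; rewrite -ltnNge => /ltnW; apply: leq_trans.
    by apply: sub_count => a /asboolP[_ _ ?]; exact/asboolP.
  rewrite (eq_count (a2 := pred0)) ?count_pred0// => a /=.
  by apply/negbTE/asboolPn => -[? ? _]; apply: nb.
- move=> j x Yx; have xd := Yd _ _ Yx.
  have [[i Gi]|nGx] := pselect (exists i, G (prefix_of x i)).
    elim: i Gi => [//|i IH] Gi; have [/IH//|nGi] := pselect (G (prefix_of x i)).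
    exists i; rewrite mem_cat; apply/orP; left.
    apply/allpairsPdep; exists (prefix_of x i), (dig (prefix_of x i) x); split=> //.
      exact: prefix_of_nodes.
    by rewrite mem_filter xd andbT; apply/asboolP.
  pose h := H (prefix_of x j, j).
  have nb : ~ bushy (Y j) h (prefix_of x j).
    by apply: (HP (prefix_of x j, j)) => /= Gx; apply: nGx; exists j.
  have : exists2 l, (l < h)%N & ~ bushy (Y j) (h - l) (prefix_of x (j + l))
        /\ bushy (Y j) (h - l).-1 (prefix_of x (j + l).+1).
    have b0 : bushy (Y j) 0 (prefix_of x (j + h)).
      by exists x => //; rewrite size_prefix_of.
    apply: contrapT => nl.
    have : forall l, (l <= h)%N -> ~ bushy (Y j) (h - l) (prefix_of x (j + l)).
      elim=> [|l IH] lh; first by rewrite subn0 addn0.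
      move=> b; apply: nl; exists l => //; split; first by apply: IH; exact: ltnW.
      by rewrite -subnS -addnS.
    by move=> /(_ h (leqnn _)); rewrite subnn.
  move=> [l lh [nbl bl]].
  have fE : fuel j (prefix_of x (j + l)) = (h - l)%N.
    by rewrite /fuel take_prefix_of size_prefix_of addKn.
  exists (j + l)%N; rewrite mem_cat; apply/orP; right.
  apply/flatten_mapP; exists j; first by rewrite mem_iota/= add0n ltnS leq_addr.
  apply/allpairsPdep; exists (prefix_of x (j + l)), (dig (prefix_of x (j + l)) x); split=> //.
    exact: prefix_of_nodes.
  rewrite mem_filter xd andbT; apply/asboolP; rewrite fE; split=> //.
  by rewrite subn_gt0.
Qed.
End Tree.

Local Open Scope ring_scope.

(** * The sup norm of row vectors *)

Lemma rV_norm_leP (R : realType) n (x : 'rV[R]_n) (r : R) : 0 <= r ->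
  `|x| <= r <-> forall j, `|x 0 j| <= r.
Proof.
move=> r0; rewrite [`|x|]mx_normrE; split=> [h j|h].
  apply: le_trans h; pose F (ij : 'I_1 * 'I_n) := `|x ij.1 ij.2|.
  by rewrite -/(F (0, j)); exact: (le_bigmax _ F (0, j)).
by apply/bigmax_leP; split=> // -[i j] _ /=; rewrite ord1.
Qed.

Lemma rV_norm_coord (R : realType) n (x : 'rV[R]_n) j : `|x 0 j| <= `|x|.
Proof. by have /(_ (lexx _)) := (rV_norm_leP x (normr_ge0 x)).1; apply. Qed.

(** * Contents, null sets, and the Hausdorff dimension *)

Section Null.
Context {R : realType}.

Lemma sum_halves N : \sum_(i < N) (2 ^- i.+1 : R) = 1 - 2 ^- N.
Proof.
elim: N => [|N IH]; first by rewrite big_ord0 expr0 invr1 subrr.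
rewrite big_ord_recr /= IH exprS; field.
by rewrite expf_neq0// pnatr_eq0.
Qed.

Lemma sum_halves_le N : \sum_(i < N) (2 ^- i.+1 : R) <= 1.
Proof. by rewrite sum_halves lerBlDr lerDl invr_ge0 exprn_ge0. Qed.

Lemma powR_root (x s : R) : 0 <= x -> s != 0 -> (x `^ s) `^ s^-1 = x.
Proof. by move=> x0 s0; rewrite -powRrM divff// powRr1. Qed.

Lemma root_powR (x s : R) : 0 <= x -> s != 0 -> (x `^ s^-1) `^ s = x.
Proof. by move=> x0 s0; rewrite -powRrM mulVf// powRr1. Qed.

Lemma powR_le_root (x y s : R) : 0 <= x -> 0 <= y -> 0 < s ->
  x `^ s <= y -> x <= y `^ s^-1.
Proof.
move=> x0 y0 s0 xy; rewrite -(powR_root x0 (lt0r_neq0 s0)).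
by apply: ge0_ler_powR; rewrite ?nnegrE ?powR_ge0// ltW// invr_gt0.
Qed.

Lemma powR_le1 (x s : R) : 0 <= x -> 0 < s -> x `^ s <= 1 -> x <= 1.
Proof.
move=> x0 s0 /(powR_le_root x0 ler01 s0); by rewrite powR1.
Qed.

(** The s-dimensional content of A is at most e.  Finite partial sums of real
    numbers replace the extended-real series, and radii are positive, so that
    the sets may be enlarged to open ones. *)
Definition content_le (T : Type) (dist : T -> T -> R) (s e : R) (A : set T) : Prop :=
  exists (U : nat -> set T) (r : nat -> R),
    [/\ A `<=` \bigcup_i U i, forall i, 0 < r i,
        forall i x y, U i x -> U i y -> dist x y <= r i &
        forall N, \sum_(i < N) r i `^ s <= e].

(** Zero content is the same as zero Hausdorff measure for s > 0: covers of small
    cost automatically consist of small sets. *)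
Definition null (T : Type) (dist : T -> T -> R) (s : R) (A : set T) : Prop :=
  forall e, 0 < e -> content_le dist s e A.

Section NullOneSpace.
Context {T : Type} (dist : T -> T -> R).

Lemma null_sub s (A B : set T) : A `<=` B -> null dist s B -> null dist s A.
Proof.
move=> AB nB e /nB[U [r [BU r0 dU sumr]]]; exists U, r; split=> //.
exact: subset_trans BU.
Qed.

(** All radii are at most 1 once the cost is. *)
Lemma null_exponent s s' (A : set T) : 0 < s -> s <= s' ->
  null dist s A -> null dist s' A.
Proof.
move=> s0 ss' nA e e0; have m0 : 0 < Num.min e 1 by rewrite lt_min e0 ltr01.
have [U [r [AU r0 dU sumr]]] := nA _ m0; exists U, r; split=> // N.
apply: le_trans (le_trans (sumr N) _); last by rewrite ge_min lexx.
apply: ler_sum => i _; apply: ger_powR => //; rewrite r0 /=.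
apply: (powR_le1 (ltW (r0 _)) s0).
have := sumr i.+1; rewrite big_ord_recr /= le_min => /andP[_]; apply: le_trans.
by rewrite lerDr sumr_ge0// => j _; exact: powR_ge0.
Qed.

(** The radii must be positive, so even the empty set needs a convergent series
    of costs; this uses s > 0. *)
Lemma null_set0 s : 0 < s -> null dist s set0.
Proof.
move=> s0 e e0; exists (fun=> set0), (fun i => (e * 2 ^- i.+1) `^ s^-1); split=> //.
  by move=> i; rewrite powR_gt0// mulr_gt0// invr_gt0 exprn_gt0.
move=> N; under eq_bigr do rewrite root_powR ?mulr_ge0 ?invr_ge0 ?exprn_ge0 ?(ltW e0) ?lt0r_neq0//.
by rewrite -mulr_sumr -[leRHS]mulr1 ler_pM2l// sum_halves_le.
Qed.

Lemma content_bigcup s (c : nat -> R) (e : R) (A : nat -> set T) :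
  (forall k, content_le dist s (c k) (A k)) -> (forall N, \sum_(k < N) c k <= e) ->
  content_le dist s e (\bigcup_k A k).
Proof.
move=> nA sum_c.
have /(_ _)/cid-/all_sig[U HU] := nA.
have /(_ _)/cid-/all_sig[r Hr] := HU.
have /card_set_bijP[f [_ f_inj f_surj]] : ([set: nat] #= [set: nat * nat])%card.
  by rewrite card_eq_sym card_nat2.
exists (fun n => U (f n).1 (f n).2), (fun n => r (f n).1 (f n).2); split.
- move=> x [k _ Akx]; have [/(_ _ Akx)[i _ Ux] _ _ _] := Hr k.
  have [n _ fn] := f_surj (k, i) I.
  by exists n => //; rewrite fn.
- by move=> n; have [_ + _ _] := Hr (f n).1; apply.
- by move=> n x y; have [_ _ + _] := Hr (f n).1; apply.
move=> N; pose M := (\max_(n < N) maxn (f n).1 (f n).2)%N.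
have fM (n : 'I_N) : ((f n).1 < M.+1)%N && ((f n).2 < M.+1)%N.
  by rewrite !ltnS -geq_max; exact: (@leq_bigmax _ (fun n : 'I_N => maxn (f n).1 (f n).2) n).
pose w (x : nat * nat) := r x.1 x.2 `^ s.
pose g (n : 'I_N) : 'I_M.+1 * 'I_M.+1 := (inord (f n).1, inord (f n).2).
have gE (n : 'I_N) : w (f n) = (fun x : 'I_M.+1 * 'I_M.+1 => w (x.1 : nat, x.2 : nat)) (g n).
  by rewrite /= !inordK; case/andP: (fM n) => //; case: (f n).
rewrite (eq_bigr _ (fun n _ => gE n)).
rewrite -(big_imset (fun x : 'I_M.+1 * 'I_M.+1 => w (x.1 : nat, x.2 : nat)) (A := predT)) /=.
  apply: (@le_trans _ _ (\sum_(x : 'I_M.+1 * 'I_M.+1) w (x.1 : nat, x.2 : nat))).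
    rewrite [leRHS](bigID (mem (g @: 'I_N))) /= lerDl sumr_ge0// => x _.
    exact: powR_ge0.
  rewrite -(pair_big xpredT xpredT (fun i j : 'I_M.+1 => w (i : nat, j : nat))) /=.
  apply: (@le_trans _ _ (\sum_(k < M.+1) c k)).
    by apply: ler_sum => k _; have [_ _ _] := Hr k; apply.
  exact: sum_c.
move=> n n' _ _ [/(congr1 val) + /(congr1 val)].
rewrite /= !inordK; try by case/andP: (fM n) => //; case/andP: (fM n').
  move=> e1 e3; apply/val_inj/f_inj; rewrite ?inE//=.
  by case: (f n) (f n') e1 e3 => [? ?] [? ?] /= -> ->.
all: by have := fM n; have := fM n'; move=> /andP[? ?] /andP[? ?].
Qed.

Lemma null_bigcup s (A : nat -> set T) :
  (forall k, null dist s (A k)) -> null dist s (\bigcup_k A k).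
Proof.
move=> nA e e0; apply: (@content_bigcup s (fun k => e * 2 ^- k.+1)) => [k|N].
  by apply: nA; rewrite mulr_gt0// invr_gt0 exprn_gt0.
by rewrite -mulr_sumr -[leRHS]mulr1 ler_pM2l// sum_halves_le.
Qed.

Lemma content_sub s e (A B : set T) : A `<=` B ->
  content_le dist s e B -> content_le dist s e A.
Proof. by move=> AB [U [r [BU *]]]; exists U, r; split=> //; exact: subset_trans BU. Qed.

Lemma content_mono s e e' (A : set T) : e <= e' ->
  content_le dist s e A -> content_le dist s e' A.
Proof. by move=> ee [U [r [? ? ? h]]]; exists U, r; split=> // N; exact: le_trans ee. Qed.

(** The cover is made infinite by adding empty sets with radii of total cost d. *)
Lemma content_list s d (bs : seq (set T * R)) : 0 < s -> 0 < d ->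
  (forall b, b \in bs -> 0 < b.2) ->
  (forall b, b \in bs -> forall x y, b.1 x -> b.1 y -> dist x y <= b.2) ->
  content_le dist s (\sum_(b <- bs) b.2 `^ s + d) [set x | exists2 b, b \in bs & b.1 x].
Proof.
move=> s0 d0 r0 dU; pose b0 : set T * R := (set0, 1).
pose r i := if (i < size bs)%N then (nth b0 bs i).2
  else (d * 2 ^- (i - size bs).+1) `^ s^-1.
exists (fun i => (nth b0 bs i).1), r; rewrite /r; split.
- by move=> x [U Us Ux]; exists (index U bs) => //=; rewrite nth_index.
- move=> i; case: ltnP => si; first by apply: r0; rewrite mem_nth.
  by rewrite powR_gt0// mulr_gt0// invr_gt0 exprn_gt0.
- move=> i x y; case: ltnP => [si|si]; last by rewrite nth_default.
  by apply: dU; rewrite mem_nth.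
- move=> N; apply: (@le_trans _ _ (\sum_(i < size bs + N) r i `^ s)).
    rewrite -!(big_mkord xpredT (fun i => r i `^ s)).
    rewrite [leRHS](@big_cat_nat _ _ _ N)//= ?leq_addl//.
    by rewrite lerDl sumr_ge0// => *; exact: powR_ge0.
  rewrite big_split_ord /= lerD//.
    rewrite (big_nth b0) big_mkord; apply: ler_sum => i _.
    by rewrite /r ltn_ord.
  under eq_bigr => i _.
    rewrite /r ltnNge leq_addr /= addKn root_powR ?mulr_ge0 ?(ltW d0) ?invr_ge0 ?exprn_ge0 ?lt0r_neq0//.
    over.
  by rewrite -mulr_sumr -[leRHS]mulr1 ler_pM2l// sum_halves_le.
Qed.

Lemma null_bigcup_count s (K : countType) (A : K -> set T) : 0 < s ->
  (forall k, null dist s (A k)) -> null dist s (\bigcup_k A k).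
Proof.
move=> s0 nA.
apply: (@null_sub _ _ (\bigcup_n (if unpickle n is Some k then A k else set0))).
  by move=> x [k _ Ax]; exists (pickle k) => //; rewrite pickleK.
apply: null_bigcup => n; by case: unpickle => [k|]; [exact: nA|exact: null_set0].
Qed.

Section Bridge.
Hypothesis dist_ge0 : forall x y, 0 <= dist x y.
Local Open Scope ereal_scope.

Lemma diam_ge0 (U : set T) : U !=set0 -> 0 <= diam dist U.
Proof.
move=> [x Ux]; apply: (@le_trans _ _ (dist x x)%:E); first by rewrite lee_fin.
by apply: ereal_sup_ubound; exists (x, x).
Qed.

Lemma diam_pow_ge0 s (U : set T) : 0 <= diam_pow dist s U.
Proof. by rewrite /diam_pow; case: ifP => // _; exact: poweR_ge0. Qed.

(** A bound on the cost bounds each radius, so the same covers are admissible for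
    every delta. *)
Lemma null_hausdorff_measure s (A : set T) : (0 < s)%R ->
  null dist s A -> ~ 0 < hausdorff_measure dist s A.
Proof.
move=> s0 nA; apply/negP; rewrite -leNgt; apply: ge_ereal_sup => _ [d d0 <-].
apply/lee_addgt0Pr => e e0; rewrite add0e.
have m0 : (0 < Num.min e (d `^ s))%R by rewrite lt_min e0 powR_gt0.
have [U [r [AU r0 dU sumr]]] := nA _ m0.
have diamU i : diam dist (U i) <= (r i)%:E.
  by apply: ge_ereal_sup => _ [[x y] [/= Ux Uy] <-]; rewrite lee_fin dU.
apply: (@le_trans _ _ (\sum_(0 <= i <oo) diam_pow dist s (U i))).
  apply: ereal_inf_lbound; exists U => //; split=> // i.
  apply: (le_trans (diamU i)); rewrite lee_fin.
  rewrite -(powR_root (ltW d0) (lt0r_neq0 s0)).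
  apply: powR_le_root => //; [exact: ltW|exact: powR_ge0|].
  have := sumr i.+1; rewrite big_ord_recr /= le_min => /andP[_]; apply: le_trans.
  by rewrite lerDr sumr_ge0// => j _; exact: powR_ge0.
apply: lime_le; first by apply: is_cvg_nneseries => *; exact: diam_pow_ge0.
apply: nearW => N; apply: (@le_trans _ _ (\sum_(0 <= i < N) (r i `^ s)%:E)).
  apply: lee_sum => i _; rewrite /diam_pow; case: ifPn => [_|/eqP/eqP/set0P U0].
    by rewrite lee_fin powR_ge0.
  rewrite -poweR_EFin; apply: gt0_ler_poweR; first exact: ltW.
  - by rewrite in_itv /= diam_ge0// leey.
  - by rewrite in_itv /= leey andbT lee_fin ltW.
  - exact: diamU.
rewrite sumEFin lee_fin big_mkord (le_trans (sumr N))//.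
by rewrite ge_min lexx.
Qed.

(** Only delta = 1 is used.  Diameters may vanish, so each is slightly enlarged,
    by an amount of summable cost. *)
Lemma hausdorff_measure_null s (A : set T) : (0 < s)%R ->
  ~ 0 < hausdorff_measure dist s A -> null dist s A.
Proof.
move=> s0 /negP; rewrite -leNgt => h e e0.
have e2 : (0 < e / 2)%R by rewrite divr_gt0.
have : hausdorff_premeasure dist s 1 A < (e / 2)%:E.
  apply: (@le_lt_trans _ _ 0); last by rewrite lte_fin.
  by apply: le_trans h; apply: ereal_sup_ubound; exists 1%R => //=.
move=> /ereal_inf_lt[_ [U [AU diam1] <-] sumU].
pose x i := fine (diam_pow dist s (U i)).
have xE i : (x i)%:E = diam_pow dist s (U i).
  rewrite fineK// ge0_fin_numE ?diam_pow_ge0// /diam_pow; case: ifPn => [_|/eqP/eqP/set0P U0].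
    exact: ltry.
  apply: (@le_lt_trans _ _ (1%:E `^ s)); last by rewrite poweR_EFin ltry.
  apply: gt0_ler_poweR; first exact: ltW.
  - by rewrite in_itv /= diam_ge0// leey.
  - by rewrite in_itv /= leey andbT lee_fin.
  - exact: diam1.
have x0 i : (0 <= x i)%R by rewrite -lee_fin xE diam_pow_ge0.
pose y i := (x i + e / 2 * 2 ^- i.+1)%R.
have y0 i : (0 < y i)%R.
  by rewrite ltr_wpDl// mulr_gt0// invr_gt0 exprn_gt0.
exists U, (fun i => (y i `^ s^-1)%R); split=> //.
- by move=> i; rewrite powR_gt0.
- move=> i u v Uu Uv.
  have duv : (dist u v)%:E <= diam dist (U i).
    by apply: ereal_sup_ubound; exists (u, v).
  apply: powR_le_root => //; first exact: ltW.
  apply: (@le_trans _ _ (x i)); last by rewrite lerDl mulr_ge0// ?ltW// invr_gt0 exprn_gt0.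
  rewrite -lee_fin xE /diam_pow; case: ifPn => [/eqP U0|_]; first by rewrite U0 in Uu.
  rewrite -poweR_EFin; apply: gt0_ler_poweR => //; first exact: ltW.
  - by rewrite in_itv /= leey andbT lee_fin.
  - by rewrite in_itv /= leey andbT (le_trans _ duv)// lee_fin.
- move=> N; under eq_bigr do rewrite root_powR ?(ltW (y0 _)) ?lt0r_neq0//.
  rewrite big_split /= [leRHS](splitr e) lerD//.
    rewrite -lee_fin -sumEFin; apply: le_trans (ltW sumU).
    under eq_bigr do rewrite xE.
    rewrite -(big_mkord xpredT (fun i => diam_pow dist s (U i))).
    by apply: nneseries_lim_ge => *; exact: diam_pow_ge0.
  by rewrite -mulr_sumr -[leRHS]mulr1 ler_pM2l// sum_halves_le.
Qed.

Lemma hausdorff_dim_le (d : R) (A : set T) : (0 <= d)%R ->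
  (forall s, (d < s)%R -> null dist s A) -> hausdorff_dim dist A <= d%:E.
Proof.
move=> d0 h; apply: ge_ereal_sup => _ [s [s0 hs] <-]; rewrite lee_fin leNgt.
apply/negP => ds; apply: (null_hausdorff_measure _ (h _ ds)) => //.
exact: le_lt_trans ds.
Qed.

Lemma hausdorff_dim_lt_null (s : R) (A : set T) : (0 < s)%R ->
  hausdorff_dim dist A < s%:E -> null dist s A.
Proof.
move=> s0 h; apply: hausdorff_measure_null => // hs; move: h.
by rewrite ltNge => /negP; apply; apply: ereal_sup_ubound; exists s => //; split=> //; exact: ltW.
Qed.

Lemma not_null_le_dim (s : R) (A : set T) : (0 < s)%R ->
  ~ null dist s A -> s%:E <= hausdorff_dim dist A.
Proof.
by move=> s0 h; rewrite leNgt; apply/negP => /(hausdorff_dim_lt_null s0).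
Qed.

Lemma lt_dim_not_null (s : R) (A : set T) : (0 < s)%R ->
  s%:E < hausdorff_dim dist A -> ~ null dist s A.
Proof.
move=> s0 h nA; move: h; rewrite ltNge => /negP; apply.
by apply: hausdorff_dim_le; [exact: ltW|move=> s' /ltW ss'; exact: null_exponent nA].
Qed.

(** In dimension 0 every nonempty set of a cover costs 1. *)
Lemma hausdorff_dim_ge0 (A : set T) : A !=set0 -> 0 <= hausdorff_dim dist A.
Proof.
move=> [x Ax]; apply: ereal_sup_ubound; exists 0%R => //; split=> //.
apply: (@lt_le_trans _ _ (hausdorff_premeasure dist 0 1 A)); last first.
  by apply: ereal_sup_ubound; exists 1%R => //=.
apply: (@lt_le_trans _ _ 1) => //.
apply: le_ereal_inf_tmp => _ [U [AU _] <-].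
have [i _ Ux] := AU _ Ax.
apply: le_trans (nneseries_lim_ge i.+1 _); last by move=> *; exact: diam_pow_ge0.
rewrite big_nat_recr//= /diam_pow; case: ifPn => [/eqP U0|_]; first by rewrite U0 in Ux.
by rewrite poweRe0 leeDr// sume_ge0// => j _; exact: diam_pow_ge0.
Qed.

End Bridge.
End NullOneSpace.

(** A relation rather than a map from A to B: it serves both for Lipschitz images
    and for preimages under expanding maps, and for charts, whose points are
    only defined up to a choice. *)
Lemma null_rel (T T' : Type) (dist : T -> T -> R) (dist' : T' -> T' -> R)
    (rel : T -> T' -> Prop) (C s : R) (A : set T) (B : set T') : 0 < C ->
  (forall x, A x -> exists2 y, B y & rel x y) ->
  (forall x x' y y', A x -> A x' -> rel x y -> rel x' y' ->
     dist x x' <= C * dist' y y') ->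
  null dist' s B -> null dist s A.
Proof.
move=> C0 AB lip nB e e0.
have c0 : 0 < C `^ s by rewrite powR_gt0.
have [U [r [BU r0 dU sumr]]] := nB _ (divr_gt0 e0 c0).
exists (fun i => [set x | A x /\ exists2 y, U i y & rel x y]), (fun i => C * r i); split.
- move=> x Ax; have [y By xy] := AB _ Ax; have [i _ Uy] := BU _ By.
  by exists i => //; split=> //; exists y.
- by move=> i; rewrite mulr_gt0.
- move=> i x x' [Ax [y Uy xy]] [Ax' [y' Uy' xy']].
  by rewrite (le_trans (lip _ _ _ _ Ax Ax' xy xy'))// ler_pM2l// dU.
- move=> N; under eq_bigr do rewrite powRM// ?(ltW C0) ?(ltW (r0 _))//.
  by rewrite -mulr_sumr mulrC -ler_pdivlMr.
Qed.

End Null.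

(** * Rapidly refining grids *)

Section Grid.
Context {R : realType} {m : nat} (q p : nat).
Local Notation V := 'rV[R]_m.

(** At level k each cell is cut into [branch k] ^ m cells, and [fineness k] is the
    product of the branching numbers before level k.  The exponent 2 ^ k makes
    fineness k.+1 = 2 ^ (q p) * fineness k ^ 2. *)
Definition branch k := (2 ^ (q * p * 2 ^ k))%N.
Definition fineness k := (2 ^ (q * p * (2 ^ k).-1))%N.
(** This is the q-th root of fineness k.+1: an arbitrarily small power of the
    inverse mesh, by which numbers of cells may be off. *)
Definition slack k := (2 ^ (p * (2 ^ k.+1).-1))%N.
Definition side k : R := 4 / (fineness k)%:R.

Lemma finenessS k : fineness k.+1 = (fineness k * branch k)%N.
Proof.
rewrite /fineness /branch -expnD -mulnDr expnS; congr (2 ^ (_ * _))%N.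
by have := expn_gt0 2 k; lia.
Qed.

Lemma fineness_gt0 k : (0 < fineness k)%N. Proof. by rewrite expn_gt0. Qed.
Lemma branch_gt0 k : (0 < branch k)%N. Proof. by rewrite expn_gt0. Qed.
Lemma slack_gt0 k : (0 < slack k)%N. Proof. by rewrite expn_gt0. Qed.

Lemma side_gt0 k : 0 < side k.
Proof. by rewrite divr_gt0// ltr0n fineness_gt0. Qed.

Lemma sideS k : side k = side k.+1 * (branch k)%:R.
Proof.
rewrite /side finenessS natrM; field.
by rewrite !pnatr_eq0 -!lt0n branch_gt0 fineness_gt0.
Qed.

Lemma side0 : side 0 = 4.
Proof. by rewrite /side /fineness expn0 muln0 expn0 divr1. Qed.

Definition digs k : seq V :=
  [seq \row_j ((f j : nat)%:R * side k.+1) | f : {ffun 'I_m -> 'I_(branch k)}].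

(** All differences of two digits, and a few more vectors. *)
Definition shifts k : seq V :=
  [seq \row_j (((f j : nat)%:R - (branch k)%:R) * side k.+1)
     | f : {ffun 'I_m -> 'I_(2 * branch k)}].

Lemma uniq_digs k : uniq (digs k).
Proof.
rewrite map_inj_uniq ?enum_uniq// => f g /rowP fg; apply/ffunP => j.
move: (fg j); rewrite !mxE => /(mulIf (lt0r_neq0 (side_gt0 _)))/eqP.
by rewrite eqr_nat => /eqP/val_inj.
Qed.

Lemma size_digs k : size (digs k) = (branch k ^ m)%N.
Proof. by rewrite size_map -cardE card_ffun !card_ord. Qed.

Lemma size_shifts k : size (shifts k) = ((2 * branch k) ^ m)%N.
Proof. by rewrite size_map -cardE card_ffun !card_ord. Qed.

Lemma sub_digs_shifts k y a : y \in digs k -> a \in digs k -> y - a \in shifts k.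
Proof.
move=> /mapP[f _ ->] /mapP[g _ ->]; apply/mapP.
have lt j : ((f j : nat) + branch k - g j < 2 * branch k)%N.
  by rewrite (leq_ltn_trans (leq_subr _ _))// mul2n -addnn ltn_add2r ltn_ord.
exists [ffun j => Ordinal (lt j)]; first by rewrite mem_enum.
apply/rowP => j; rewrite !mxE ffunE /= natrB; last by rewrite ltnW// ltn_addl// ltn_ord.
by rewrite natrD; ring.
Qed.

Lemma norm_shifts k e : e \in shifts k -> `|e| <= side k.
Proof.
move=> /mapP[f _ ->]; apply/rV_norm_leP; first exact: ltW (side_gt0 _).
move=> j; rewrite mxE normrM (ger0_norm (ltW (side_gt0 _))) (sideS k) mulrC.
rewrite ler_pM2l ?side_gt0//.
have : ((f j : nat)%:R <= 2 * (branch k)%:R :> R).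
  by rewrite -(natrM _ 2) ler_nat ltnW.
have : (0 <= (f j : nat)%:R :> R) by [].
by rewrite ler_norml; lra.
Qed.

(** The root cell is [-2, 2[^m: it contains the closed unit ball, and being
    half-open it needs no special case at the boundary. *)
Definition corner (Q : seq V) : V := const_mx (- 2) + \sum_(d <- Q) d.
Definition in_cell (Q : seq V) (y : V) :=
  forall j : 'I_m, 0 <= (y - corner Q) 0 j < side (size Q).
(** The digit is itself the displacement from the corner of the cell to that of
    the child containing y; then differences of digits are translations. *)
Definition digit (Q : seq V) (y : V) : V :=
  \row_j ((Num.truncn ((y - corner Q) 0 j / side (size Q).+1))%:R * side (size Q).+1).

Lemma corner_rcons Q a : corner (rcons Q a) = corner Q + a.
Proof. by rewrite /corner -cats1 big_cat big_seq1 /= addrA. Qed.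

Lemma digit_digs Q y : in_cell Q y -> digit Q y \in digs (size Q).
Proof.
move=> Qy; have lt (j : 'I_m) :
    (Num.truncn ((y - corner Q) 0 j / side (size Q).+1)%R < branch (size Q))%N.
  have /andP[y0 y1] := Qy j; have s0 := side_gt0 (size Q).+1.
  have /truncn_itv/andP[t0 _] : 0 <= (y - corner Q) 0 j / side (size Q).+1.
    by rewrite divr_ge0// ltW.
  rewrite -(ltr_nat R); apply: (le_lt_trans t0).
  by rewrite ltr_pdivrMr// mulrC -sideS.
apply/mapP; exists [ffun j => Ordinal (lt j)]; first by rewrite mem_enum.
by apply/rowP => j; rewrite [LHS]mxE [RHS]mxE ffunE.
Qed.

Lemma digit_remainder Q y (j : 'I_m) : in_cell Q y ->
  0 <= (y - corner Q - digit Q y) 0 j < side (size Q).+1.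
Proof.
move=> Qy; have /andP[y0 y1] := Qy j; have s0 := side_gt0 (size Q).+1.
have y0' : 0 <= (y - corner Q) 0 j / side (size Q).+1 by rewrite divr_ge0// ltW.
have /andP[] := truncn_itv y0'.
rewrite ler_pdivlMr// ltr_pdivrMr// -natr1 !mxE => h1 h2.
by apply/andP; split; lra.
Qed.

(** If y is in the child of Q with digit d, then y - e is in the child with digit
    d - e, whether or not y - e is in Q. *)
Lemma in_cell_child Q y e : in_cell Q y -> in_cell (rcons Q (digit Q y - e)) (y - e).
Proof.
move=> Qy j; rewrite size_rcons corner_rcons.
have := digit_remainder j Qy; rewrite !mxE.
rewrite (_ : forall a b c d : R, a - b - (c + (d - b)) = a - c - d)//.
by move=> *; ring.
Qed.

Lemma in_cell_root x : `|x| <= 1 -> in_cell [::] x.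
Proof.
move=> /rV_norm_leP h j; rewrite side0 !mxE big_nil mxE.
have := h ler01 j; rewrite ler_norml => /andP[? ?]; apply/andP; split; lra.
Qed.

Lemma in_cell_prefix x k : `|x| <= 1 -> in_cell (prefix_of digit x k) x.
Proof.
move=> x1; elim: k => [|k IH]; first exact: in_cell_root.
by have := in_cell_child 0 IH; rewrite !subr0.
Qed.

Lemma in_cell_dist Q x y : in_cell Q x -> in_cell Q y -> `|x - y| <= side (size Q).
Proof.
move=> Qx Qy; apply/rV_norm_leP; first exact: ltW (side_gt0 _).
move=> j; have := Qx j; have := Qy j; rewrite !mxE ler_norml => /andP[? ?] /andP[? ?].
by apply/andP; split; lra.
Qed.

(** The number branch k ^ m / slack k ^ 2, see [popularityE]: the fraction
    slack k ^ -2 of all children. *)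
Definition popularity k := (2 ^ (m * (q * p * 2 ^ k) - 2 * (p * (2 ^ k.+1).-1)))%N.

Hypothesis mq4 : (4 <= m * q)%N.

(** The condition 4 <= m q makes the exponent of [popularity] nonnegative. *)
Lemma popularityE k : (popularity k * slack k ^ 2 = branch k ^ m)%N.
Proof.
rewrite /popularity /slack /branch -!expnM -expnD; congr (2 ^ _)%N.
rewrite expnS; have := expn_gt0 2 k => /=; move: (2 ^ k)%N => x x0.
by rewrite [X in (_ + X)%N]mulnC subnK; nia.
Qed.

Notation bushy := (bushy digs digit popularity).
Notation nodes := (nodes digs).

(** The members to be hit are the pairs of a bushy cell Q and a digit y, and e hits
    (Q, y) if y - e is a bushy child of Q.  The same E serves for all cells. *)
Lemma level_hitting A h k : exists E : seq V,
  [/\ (size E <= (2 ^ m * slack k ^ 2) * (q * m * (p * (2 ^ k.+1).-1)).+1)%N,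
      {subset E <= shifts k} &
      forall Q, Q \in nodes k -> bushy A h.+1 Q -> forall y, y \in digs k ->
        exists2 e, e \in E & y - e \in digs k /\ bushy A h (rcons Q (y - e))].
Proof.
pose fam := [seq Qy <- [seq (Q, y) | Q <- nodes k, y <- digs k] | `[< bushy A h.+1 Qy.1 >]].
pose P (Qy : seq V * V) : pred V :=
  fun e => (Qy.2 - e \in digs k) && `[< bushy A h (rcons Qy.1 (Qy.2 - e)) >].
have [||||Qy|E [sE sub hit]] := @hitting_set _ _ P (shifts k) (popularity k)
    (2 ^ m * slack k ^ 2)%N _ _ fam (q * m * (p * (2 ^ k.+1).-1)).+1.
- by rewrite expn_gt0.
- by rewrite size_shifts expnMn -mulnA (mulnC (slack k ^ 2)%N) popularityE.
- by rewrite muln_gt0 !expn_gt0.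
- apply: (@leq_ltn_trans (fineness k.+1 ^ m)%N).
    rewrite size_filter (leq_trans (count_size _ _))// size_allpairs size_nodes.
    under eq_bigr do rewrite size_digs.
    rewrite size_digs leq_eqVlt; apply/orP; left; apply/eqP.
    elim: k {fam P} => [|k IH]; first by rewrite big_ord0 finenessS mul1n /fineness expn0 muln0 mul1n.
    by rewrite big_ord_recr /= IH -expnMn -finenessS.
  by rewrite /fineness -expnM ltn_exp2l//; nia.
- rewrite mem_filter => /andP[/asboolP hQ /allpairsP[[Q y] /= [Qk yk E]]].
  rewrite {}E /= in hQ *.
  have sQ := mem_nodes Qk; move: hQ; rewrite sQ => /leq_trans; apply.
  rewrite -2!size_filter -(size_map (fun a => y - a)).
  apply: uniq_leq_size.
    by rewrite map_inj_uniq ?filter_uniq ?uniq_digs// => a b /addrI/oppr_inj.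
  move=> e /mapP[a]; rewrite !mem_filter => /andP[ha ak ->].
  by rewrite /P /= subKr ak ha sub_digs_shifts.
exists E; split=> // Q Qk bQ y yk.
have /hit/hasP[e eE /andP[h1 /asboolP h2]] : (Q, y) \in fam.
  by rewrite mem_filter; apply/andP; split; [exact/asboolP|apply/allpairsP; exists (Q, y)].
by exists e.
Qed.

Fixpoint sumset (E : nat -> seq V) k : seq V :=
  if k is k'.+1 then [seq u + e | u <- sumset E k', e <- E k'] else [:: 0].

(** Descending the tree: if x - e lies in a bushy cell Q, a shift e' from the next
    level moves it into a bushy child of Q. *)
Lemma bushy_sumset A K : bushy A K [::] -> (forall x, A x -> `|x| <= 1) ->
  exists E : nat -> seq V,
  [/\ forall k, (size (E k) <=
        (2 ^ m * slack k ^ 2) * (q * m * (p * (2 ^ k.+1).-1)).+1)%N,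
      forall k, {subset E k <= shifts k} &
      forall x, `|x| <= 1 -> exists2 e, e \in sumset E K &
        exists2 v, A v & `|x - e - v| <= side K].
Proof.
move=> bK A1.
have /(_ _)/cid-/all_sig[E HE] := fun k => level_hitting A (K - k).-1 k.
exists E; split=> [k|k|x x1]; [by case: (HE k)|by case: (HE k)|].
have : forall k, (k <= K)%N -> exists2 e, e \in sumset E k &
    exists2 Q, Q \in nodes k & bushy A (K - k) Q /\ in_cell Q (x - e).
  elim=> [_|k IH kK].
    exists 0; rewrite ?mem_head//; exists [::]; rewrite ?mem_head//.
    by rewrite subn0 subr0; split=> //; exact: in_cell_root.
  have [e ek [Q Qk [bQ cQ]]] := IH (ltnW kK).
  have [_ _ /(_ Q Qk)] := HE k.
  rewrite prednK ?subn_gt0// => /(_ bQ (digit Q (x - e))).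
  rewrite -{1}(mem_nodes Qk) digit_digs// => /(_ isT)[e' e'E [d' b']].
  exists (e + e'); first by apply/allpairsP; exists (e, e').
  exists (rcons Q (digit Q (x - e) - e')); first exact: nodesS.
  by rewrite subnS opprD addrA; split=> //; exact: in_cell_child.
move=> /(_ K (leqnn _))[e eK [Q QK]]; rewrite subnn => -[[v Av vQ] cQ].
exists e => //; exists v => //; rewrite -(mem_nodes QK).
apply: in_cell_dist => //; rewrite -vQ; apply: in_cell_prefix; exact: A1.
Qed.

End Grid.

(** * A set of translations of small dimension *)

Section SumsetCover.
Context {R : realType} {m : nat}.
Local Notation V := 'rV[R]_m.
Notation ndist := (fun x y : V => `|x - y|).

Section Scales.
Variables (q p : nat).

Notation side := (@side R q p).
Notation shifts := (@shifts R m q p).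

(** The doubly exponential growth makes the last factor comparable with the
    product of all the factors. *)
Lemma size_sumset (E : nat -> seq V) k :
  (forall i, (size (E i) <= slack p i ^ 4)%N) ->
  (size (sumset E k) <= 2 ^ (4 * p * 2 ^ k.+1))%N.
Proof.
move=> sE; apply: (@leq_trans (2 ^ (4 * p * (2 ^ k.+1 - 2)))); last first.
  by rewrite leq_exp2l// leq_mul2l leq_subr orbT.
elim: k => [|k IH]; first by rewrite subnn muln0.
rewrite /= size_allpairs; apply: (leq_trans (leq_mul IH (sE k))).
rewrite /slack -expnM -expnD leq_exp2l// !expnS.
have : (0 < 2 ^ k)%N by rewrite expn_gt0.
move: (2 ^ k)%N => x; nia.
Qed.

Lemma fineness_slack k : fineness q p k.+1 = (slack p k ^ q)%N.
Proof. by rewrite /fineness /slack -expnM; congr (2 ^ _)%N; lia. Qed.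

Lemma pow2_powR n : (2 ^ n)%N%:R = 2 `^ n%:R :> R.
Proof. by rewrite powR_mulrn// natrX. Qed.

Hypotheses (q_gt0 : (0 < q)%N) (p_gt0 : (0 < p)%N).

Lemma side_half k : side k.+1 <= side k / 2.
Proof.
rewrite ler_pdivlMr ?ltr0n// (sideS _ _ k) ler_pM2l ?side_gt0// ler_nat /branch.
by rewrite -{1}(expn1 2) leq_exp2l// !muln_gt0 q_gt0 p_gt0 expn_gt0.
Qed.

(** The shifts of level i have norm at most side i, and these norms decrease
    geometrically. *)
Lemma sumset_approx (E : nat -> seq V) : (forall k, {subset E k <= shifts k}) ->
  forall j K, (j <= K)%N -> forall e, e \in sumset E K ->
  exists2 e', e' \in sumset E j & `|e - e'| <= 2 * (side j - side K).
Proof.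
move=> EU j; elim=> [|K IH]; first by rewrite leqn0 => /eqP -> e eE; exists e; rewrite // !subrr mulr0 normr0.
rewrite leq_eqVlt ltnS => /predU1P[->|jK] e; first by exists e; rewrite // !subrr mulr0 normr0.
move=> /allpairsP[[u d] /= [uE dE ->]]; have [e' e'E h] := IH jK _ uE.
exists e' => //; rewrite addrAC (le_trans (ler_normD _ _))//.
have := side_half K; have := norm_shifts (EU _ _ dE); lra.
Qed.

Lemma slack_ge k : (2 ^ p * 2 ^ k * 2 ^ k <= slack p k)%N.
Proof.
rewrite /slack -!expnD leq_exp2l// expnS.
have : (k < 2 ^ k)%N by exact: ltn_expl.
move: (2 ^ k)%N => x; nia.
Qed.

Lemma fineness_ge k : (2 ^ k <= (fineness q p k).*2)%N.
Proof.
rewrite /fineness -mul2n -expnS leq_exp2l//.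
have : (k < 2 ^ k)%N by exact: ltn_expl.
case: (2 ^ k)%N => // x; rewrite ltnS /= => kx.
have : (1 <= q * p)%N by rewrite muln_gt0 q_gt0.
nia.
Qed.

Lemma side_small (d : R) : 0 < d -> exists K, side K <= d.
Proof.
move=> d0; pose K := (Num.truncn (8 / d)).+1; exists K.
have hK : 8 / d <= K%:R.
  by apply: ltW; have /truncn_itv/andP[] : 0 <= 8 / d by rewrite divr_ge0// ltW.
have : (K%:R <= 2 * (fineness q p K)%:R :> R).
  rewrite -natrM ler_nat mul2n; apply: leq_trans (fineness_ge K).
  by apply: ltnW; exact: ltn_expl.
move: hK; rewrite ler_pdivrMr// /side ler_pdivrMr ?ltr0n ?fineness_gt0//.
set x : R := K%:R; set y : R := _%:R => h1 h2; nra.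
Qed.

(** Here k is the number of levels whose mesh exceeds rho.  Each mesh is about the
    square of the previous one, hence 1 / rho is at least about the square root
    of fineness k, and a power of it with exponent tau still exceeds the number
    of sums when q is large.  The factor 2 ^ (16 p) takes care of the first
    levels. *)
Lemma covering_number (tau rho : R) k : 16 <= tau * q%:R -> 0 < rho <= 1 ->
  (forall i, (i < k)%N -> rho < (fineness q p i)%:R^-1) ->
  (2 ^ (4 * p * 2 ^ k.+1))%N%:R <= (2 ^ (16 * p))%N%:R * rho `^ (- tau).
Proof.
move=> tauq /andP[rho0 rho1] small.
have tau0 : 0 < tau.
  have : 0 < tau * q%:R by apply: lt_le_trans tauq.
  by rewrite pmulr_lgt0// ltr0n.
case: k small => [|k] small.
  apply: (@le_trans _ _ (2 ^ (16 * p))%N%:R).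
    by rewrite ler_nat leq_exp2l//; lia.
  rewrite ler_peMr// powRN invf_ge1 ?powR_gt0//.
  rewrite (_ : 1 = 1 `^ tau); last by rewrite powR1.
  by apply: ge0_ler_powR; rewrite ?nnegrE ?(ltW tau0) ?(ltW rho0).
rewrite powRN; have rt0 : 0 < rho `^ tau by rewrite powR_gt0.
rewrite ler_pdivlMr//.
pose y := (2 ^ k).-1%N.
have h : rho `^ tau <= 2 `^ (- (q * p * y)%:R * tau).
  rewrite powRrM; apply: ge0_ler_powR; rewrite ?nnegrE ?powR_ge0 ?(ltW tau0) ?(ltW rho0)//.
  by rewrite powRN -pow2_powR; apply/ltW/small.
apply: (@le_trans _ _ ((2 ^ (4 * p * 2 ^ k.+2))%:R * 2 `^ (- (q * p * y)%:R * tau))).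
  by rewrite ler_pM2l// ltr0n expn_gt0.
rewrite !pow2_powR -powRD; last by rewrite pnatr_eq0 implybT.
apply: ler_powR; first by rewrite ler1n.
have : (2 ^ k = y + 1)%N by rewrite addn1 /y prednK// expn_gt0.
rewrite !expnS => ->; rewrite !natrM !natrD.
have y0 : 0 <= y%:R :> R by [].
have pp : 0 < p%:R :> R by rewrite ltr0n.
have : 16 * (p%:R * y%:R) <= tau * q%:R * (p%:R * y%:R).
  by rewrite ler_wpM2r// mulr_ge0// ltW.
by rewrite (_ : 1%:R = 1 :> R)//; nra.
Qed.


Hypotheses (m_gt0 : (0 < m)%N) (q_ge4 : (4 <= q)%N).

Let sigma : R := m%:R - q%:R^-1.

Lemma mq_ge4 : (4 <= m * q)%N.
Proof. by rewrite (leq_trans q_ge4)// leq_pmull. Qed.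

Lemma sigma_gt0 : 0 < sigma.
Proof.
rewrite subr_gt0; apply: (@lt_le_trans _ _ 1); last by rewrite ler1n.
by rewrite invf_lt1 ?ltr0n// ltr1n (leq_trans _ q_ge4).
Qed.

(** The number of cells of level k.+1 which may occur in a sparse cover is
    k.+3 * fineness k.+1 ^ m / slack k ^ 2.  Each costs at most
    4 ^ m * slack k / fineness k.+1 ^ m, since sigma = m - 1/q; one factor
    slack k is left. *)
Lemma level_cost k :
  (k.+3 * (fineness q p k ^ m * popularity (m:=m) q p k))%N%:R * side k.+1 `^ sigma
    <= 6 * 4 ^+ m / 2 ^+ p * 2 ^- k.+1.
Proof.
set P := (fineness q p k ^ m * _)%N; set s : R := (slack p k)%:R.
have s0 : 0 < s by rewrite ltr0n slack_gt0.
have PE : P%:R * s ^+ 2 = s ^+ (q * m).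
  rewrite -!natrX -natrM /P -mulnA popularityE ?mq_ge4// -expnMn -finenessS.
  by rewrite fineness_slack expnM.
have sideE : side k.+1 `^ sigma = 4 `^ sigma * s / s ^+ (q * m).
  rewrite /side fineness_slack natrX powRM ?invr_ge0 ?exprn_ge0 ?ltW//.
  rewrite -mulrA; congr (_ * _).
  rewrite -powR_inv1 ?exprn_ge0 ?ltW// -powRrM -powR_mulrn ?ltW//.
  rewrite -powR_mulrn ?ltW// -[X in X / _]powRr1 ?ltW// -powRN -powRrM -powRD; last first.
    by rewrite (gt_eqF s0) implybT.
  congr (_ `^ _); rewrite /sigma natrM; field.
  by rewrite pnatr_eq0 -lt0n.
have sm : 0 < s ^+ (q * m) by rewrite exprn_gt0.
have -> : (k.+3 * P)%N%:R * side k.+1 `^ sigma = k.+3%:R * 4 `^ sigma / s.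
  have Pn : P%:R != 0 :> R.
    by apply/eqP => P0; move: sm; rewrite -PE P0 mul0r ltxx.
  rewrite sideE -PE natrM; field.
  by rewrite ?(gt_eqF s0) ?Pn.
have h4 : 4 `^ sigma <= 4 ^+ m :> R.
  rewrite -powR_mulrn//; apply: ler_powR; first by rewrite ler1n.
  by rewrite /sigma gerBl invr_ge0.
have hs : 2 ^+ p * 2 ^+ k * 2 ^+ k <= s.
  by rewrite -!natrX -!natrM ler_nat; exact: slack_ge.
have hk : k.+3%:R <= 3 * 2 ^+ k :> R.
  rewrite -natrX -natrM ler_nat; have : (k < 2 ^ k)%N by exact: ltn_expl.
  by move: (2 ^ k)%N => x; lia.
have p20 : 0 < 2 ^+ p :> R by rewrite exprn_gt0.
have k20 : 0 < 2 ^+ k :> R by rewrite exprn_gt0.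
rewrite ler_pdivrMr//.
apply: (@le_trans _ _ (3 * 2 ^+ k * 4 ^+ m)).
  by apply: ler_pM => //; exact: powR_ge0.
apply: (@le_trans _ _ (6 * 4 ^+ m / 2 ^+ p * 2 ^- k.+1 * (2 ^+ p * 2 ^+ k * 2 ^+ k))).
  rewrite exprS le_eqVlt; apply/orP; left; apply/eqP; field.
  by rewrite !gt_eqF.
by rewrite ler_pM2l// !mulr_gt0// ?invr_gt0 ?exprn_gt0.
Qed.

Notation bushy := (bushy (@digs R m q p) (@digit R m q p) (popularity (m:=m) q p)).
Notation prefix_of := (prefix_of (@digit R m q p)).

Lemma sparse_content (X : set V) (F : nat -> seq (seq V)) :
  (forall x, X x -> `|x| <= 1) ->
  (forall i Q, Q \in F i -> size Q = i.+1) ->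
  (forall i, (size (F i) <=
     i.+2 * ((\prod_(l < i) size (@digs R m q p l)) * popularity (m:=m) q p i))%N) ->
  (forall x, X x -> exists i, prefix_of x i.+1 \in F i) ->
  content_le ndist sigma (6 * 4 ^+ m / 2 ^+ p) X.
Proof.
move=> X1 sQ sF XF.
pose cells i := [seq ([set y | in_cell q p Q y], side i.+1) | Q <- F i].
apply: (@content_sub _ _ _ _ _ _ (\bigcup_i [set x | exists2 b, b \in cells i & b.1 x])).
  move=> x Xx; have [i iF] := XF _ Xx; exists i => //=.
  exists ([set y | in_cell q p (prefix_of x i.+1) y], side i.+1); first exact: map_f.
  by apply: in_cell_prefix; exact: X1.
apply: (@content_bigcup _ _ _ _ (fun i => (size (F i)).+1%:R * side i.+1 `^ sigma)).
  move=> i; rewrite -natr1 mulrDl mul1r.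
  rewrite (_ : _ * _ = \sum_(b <- cells i) b.2 `^ sigma); last first.
    by rewrite big_map /= big_const_seq count_predT iter_addr_0 mulr_natl.
  apply: content_list; [exact: sigma_gt0|by rewrite powR_gt0// side_gt0| |].
    by move=> _ /mapP[Q _ ->]; exact: side_gt0.
  move=> _ /mapP[Q /sQ QE ->] x y /= Qx Qy; rewrite -QE; exact: in_cell_dist.
move=> N; apply: (@le_trans _ _ (\sum_(i < N) 6 * 4 ^+ m / 2 ^+ p * 2 ^- i.+1)).
  apply: ler_sum => i _; apply: le_trans (level_cost i).
  rewrite ler_wpM2r ?powR_ge0// ler_nat.
  have -> : (fineness q p i ^ m = \prod_(l < i) size (@digs R m q p l))%N.
    elim: (i : nat) => [|k IH]; first by rewrite big_ord0 /fineness expn0 muln0 exp1n.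
    by rewrite big_ord_recr /= -IH size_digs finenessS expnMn.
  have : (0 < popularity (m:=m) q p i)%N by rewrite expn_gt0.
  have : (0 < \prod_(l < i) size (@digs R m q p l))%N.
    by apply: prodn_gt0 => l; rewrite size_digs expn_gt0 branch_gt0.
  have := sF i; move: (size _) (\prod_(l < i) _)%N (popularity _ _ _) => a b c.
  by nia.
by rewrite -mulr_sumr -[leRHS]mulr1 ler_wpM2l ?sum_halves_le.
Qed.

End Scales.

(** E is bounded and has upper box dimension at most tau, with explicit constants. *)
Definition small_sumset (C tau : R) (E : seq V) :=
  (forall e, e \in E -> `|e| <= C) /\
  forall rho, 0 < rho <= 1 -> exists2 E' : seq V,
    (size E')%:R <= C * rho `^ (- tau) &
    forall e, e \in E -> exists2 e', e' \in E' & `|e - e'| <= C * rho.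

(** The point of the statement is the order of the quantifiers: C depends on X
    only, whereas the Y j exhausting X are arbitrary.  The set X + E
    would fill the unit ball up to delta, with E of dimension tau; for the sake of
    openness X is replaced by one of the Y j. *)
Lemma sumset_cover (tau : R) : 0 < tau -> exists2 sigma : R,
  0 < sigma /\ ((0 < m)%N -> sigma < m%:R) &
  forall X : set V, X !=set0 -> (forall x, X x -> `|x| <= 1) ->
    ((0 < m)%N -> ~ null ndist sigma X) ->
  exists2 C : R, 1 <= C & forall Y : nat -> set V,
    (forall i j, (i <= j)%N -> Y i `<=` Y j) ->
    (forall j, Y j `<=` X) -> X `<=` \bigcup_j Y j ->
  exists j, forall delta : R, 0 < delta -> exists2 E : seq V, small_sumset C tau E &
    forall x, `|x| <= 1 -> exists2 e, e \in E & exists2 v, Y j v & `|x - e - v| <= delta.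
Proof.
move=> tau0; have [m0|m_gt0] := posnP m.
  (* With a single slope, E = {0} will do. *)
  exists 1; first by split=> //; rewrite m0.
  move=> X [x0 Xx0] X1 _; exists 1 => // Y _ _ /(_ _ Xx0)[j _ Yx0].
  have V0 (u : V) : u = 0 by apply/rowP => i; have := ltn_ord i; rewrite [in X in (_ < X)%N]m0.
  exists j => d d0; exists [:: 0].
    split=> [e _|rho /andP[rho0 rho1]]; first by rewrite (V0 e) normr0.
    exists [:: 0]; last by move=> e _; exists 0; rewrite ?mem_head// (V0 (e - 0)) normr0 mul1r ltW.
    rewrite mul1r powRN invf_ge1 ?powR_gt0//.
    rewrite (_ : 1 = 1 `^ tau); last by rewrite powR1.
    by apply: ge0_ler_powR; rewrite ?nnegrE ?(ltW tau0) ?(ltW rho0).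
  move=> x _; exists 0; rewrite ?mem_head//; exists x0 => //.
  by rewrite (V0 (x - 0 - x0)) normr0 ltW.
(* q is large for the covering numbers, and p absorbs the constants: the size
   of the hitting sets, and the content c of X. *)
pose q := (Num.truncn (16 / tau)).+4.
have tauq : 16 <= tau * q%:R.
  rewrite mulrC -ler_pdivrMr//.
  have /truncn_itv/andP[_ /ltW h] : 0 <= 16 / tau by rewrite divr_ge0// ltW.
  by apply: (le_trans h); rewrite ler_nat /q; move: (Num.truncn _) => u; lia.
have q_ge4 : (4 <= q)%N by [].
have q_gt0 : (0 < q)%N by [].
exists (m%:R - q%:R^-1).
  by split; [exact: sigma_gt0|rewrite gtrBl invr_gt0 ltr0n].
move=> X _ X1 /(_ isT)/existsNP[c /not_implyP[c0 nX]].
pose t := (Num.truncn (6 * 4 ^+ m / c)).+1.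
pose p := (m + (q * m).+1 + t)%N.
have p_gt0 : (0 < p)%N by rewrite /p addnS.
have hp1 : (2 ^ m * (q * m).+1 <= 2 ^ p)%N.
  rewrite /p -addnA expnD leq_mul2l expnD; apply/orP; right.
  rewrite (leq_trans (ltnW (ltn_expl (q * m).+1 (ltnSn 1))))// leq_pmulr//.
  by rewrite expn_gt0.
have hp2 : 6 * 4 ^+ m / 2 ^+ p <= c.
  rewrite ler_pdivrMr ?exprn_gt0// [leRHS]mulrC -ler_pdivrMr//.
  have h0 : 0 <= 6 * 4 ^+ m / c by rewrite divr_ge0 ?mulr_ge0 ?exprn_ge0// ltW.
  have /truncn_itv/andP[_ /ltW h] := h0; apply: (le_trans h).
  rewrite -(natrX _ 2 p) ler_nat (leq_trans (ltnW (ltn_expl t (ltnSn 1))))//.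
  by rewrite leq_exp2l// leq_addl.
exists (2 ^ (16 * p))%N%:R; first by rewrite ler1n expn_gt0.
move=> Y Ym YX XY.
have N0 k : (0 < popularity (m:=m) q p k)%N by rewrite expn_gt0.
have [|[j bY]|[F [F1 F2 F3]]] := @bushy_or_sparse V V (@digs R m q p)
    (@digit R m q p) (popularity (m:=m) q p) N0 Y Ym.
- move=> j x /YX/X1 x1 k; rewrite -{2}(size_prefix_of (@digit R m q p) x k).
  by apply: digit_digs; exact: in_cell_prefix.
- exists j => d d0; have [K hK] := side_small q_gt0 p_gt0 d0.
  have [|E [sE EU hE]] := @bushy_sumset R m q p (mq_ge4 m_gt0 q_ge4) (Y j) K (bY K).
    by move=> x /YX/X1.
  have sE4 k : (size (E k) <= slack p k ^ 4)%N.
    apply: (leq_trans (sE k)); rewrite /slack.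
    have : (2 ^ p <= 2 ^ (p * (2 ^ k.+1).-1))%N.
      rewrite leq_exp2l// leq_pmulr// -subn1 subn_gt0.
      by rewrite -{1}(expn0 2) ltn_exp2l.
    have := ltn_expl (p * (2 ^ k.+1).-1) (ltnSn 1).
    move: (p * _)%N => y; move: hp1; move: (2 ^ y)%N (2 ^ m)%N (2 ^ p)%N => s M P h1 h2 h3.
    have h4 : ((q * m * y).+1 <= (q * m).+1 * s)%N by nia.
    apply: (@leq_trans (M * s ^ 2 * ((q * m).+1 * s))); first by rewrite leq_mul2l h4 orbT.
    have -> : (M * s ^ 2 * ((q * m).+1 * s) = M * (q * m).+1 * s ^ 3)%N by ring.
    by rewrite (expnS s 3) leq_mul2r (leq_trans h1 h3) orbT.
  have C8 : 8 <= (2 ^ (16 * p))%N%:R :> R.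
    by rewrite (_ : 8 = (2 ^ 3)%N%:R)// ler_nat leq_exp2l//; move: p_gt0; lia.
  exists (sumset E K); last first.
    move=> x /hE[e eE [v Yv h]]; exists e => //; exists v => //; exact: le_trans hK.
  have approx k e : (k <= K)%N -> e \in sumset E K ->
      exists2 e', e' \in sumset E k & `|e - e'| <= 8 / (fineness q p k)%:R.
    move=> kK /(sumset_approx q_gt0 p_gt0 EU kK)[e' e'E h]; exists e' => //.
    apply: (le_trans h); rewrite mulrBr lerBlDr.
    have := side_gt0 (R:=R) q p K; rewrite /side; lra.
  split.
    move=> e /(approx 0%N _ (leq0n K))[e']; rewrite inE => /eqP ->.
    rewrite subr0 /fineness expn0 muln0 expn0 divr1 => /le_trans; exact.
  move=> rho /andP[rho0 rho1].
  have [k kK [small fin]] : exists2 k, (k <= K)%N &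
      (forall i, (i < k)%N -> rho < (fineness q p i)%:R^-1) /\
      ((fineness q p k)%:R^-1 <= rho \/ k = K).
    elim: K {hK hE approx} => [|K [k kK [small fin]]].
      by exists 0%N => //; split=> //; right.
    have [h|h] := leP (fineness q p k)%:R^-1 rho.
      by exists k; [exact: leqW|split=> //; left].
    case: fin => [|kE]; first by rewrite leNgt h.
    exists K.+1 => //; split; last by right.
    by move=> i; rewrite ltnS leq_eqVlt -{1}kE => /predU1P[->//|]; rewrite -kE; exact: small.
  exists (sumset E k).
    have r01 : 0 < rho <= 1 by rewrite rho0.
    apply: le_trans (covering_number q_gt0 p_gt0 tauq r01 small).
    by rewrite ler_nat; exact: size_sumset.
  move=> e eE; case: fin => [fin|kE].
    have [e' e'E h] := approx k e kK eE; exists e' => //; apply: (le_trans h).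
    by apply: ler_pM => //; rewrite ?invr_ge0.
  by exists e; rewrite ?kE// subrr normr0 mulr_ge0 ?ltW.
- exfalso; apply: nX; apply: (content_mono hp2).
  by apply: (sparse_content q_gt0 p_gt0 m_gt0 q_ge4 X1 F1 F2) => x /XY[j _ /F3].
Qed.

End SumsetCover.

(** * Thin tubes in every direction *)

Lemma sum_seq_const (R : realType) (I : Type) (s : seq I) (c : R) :
  \sum_(i <- s) c = (size s)%:R * c.
Proof. by rewrite big_const_seq count_predT iter_addr_0 mulr_natl. Qed.

Section Tubes.
Context {R : realType} {m : nat}.
Local Notation V := 'rV[R]_m.
Notation ndist := (fun x y => `|x - y|).

Lemma prod_norm_leP (u : V * R) (r : R) : `|u| <= r <-> `|u.1| <= r /\ `|u.2| <= r.
Proof.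
rewrite prod_normE ge_max; split=> [/andP[]//|[? ?]]; exact/andP.
Qed.

Definition boxes (bs : seq ((V * R) * R)) : set (V * R) :=
  [set u | exists2 b, b \in bs & `|u - b.1| <= b.2].

Lemma closed_box (c : V * R) (r : R) : closed [set u : V * R | `|u - c| <= r].
Proof.
apply: (@preimage_closed _ _ (fun u : V * R => `|u - c|) [set x : R | x <= r]); last exact: closed_le.
move=> u _; apply: (@continuous_comp _ _ _ (fun u : V * R => u - c) (fun u => `|u|)).
  by apply: cvgB; [exact: cvg_id|exact: cvg_cst].
exact: norm_continuous.
Qed.

Lemma closed_boxes bs : closed (boxes bs).
Proof.
elim: bs => [|b bs IH].
  rewrite (_ : boxes [::] = set0); first exact: closed0.
  by apply/seteqP; split=> u //= [].
rewrite (_ : boxes _ = [set u | `|u - b.1| <= b.2] `|` boxes bs).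
  by apply: closedU => //; exact: closed_box.
apply/seteqP; split=> u /=.
  by move=> [c]; rewrite inE => /predU1P[->|cs h]; [left|right; exists c].
by move=> [h|[c cs h]]; [exists b; rewrite ?mem_head|exists c; rewrite // inE cs orbT].
Qed.

(** Finite covers by boxes, so that images under affine maps are easy to cost. *)
Definition box_cover (s e : R) (W : set (V * R)) :=
  exists bs : seq ((V * R) * R),
    [/\ forall b, b \in bs -> 0 < b.2, W `<=` boxes bs & \sum_(b <- bs) b.2 `^ s <= e].

Definition has_tubes (L A h : R) (W : set (V * R)) :=
  forall x : V, `|x| <= 1 -> exists2 a : V, `|a| <= A &
    forall t, `|t| <= L -> forall u, `|u - (a + t *: x, t)| <= h -> W u.

(** A Lebesgue number argument for the compact segment, in which finitely many
    of the sets suffice and leave room for a neighbourhood of the segment. *)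
Lemma segment_uniform_cover (a x : V) (L : R) (U : nat -> set (V * R))
    (r : nat -> R) (c : nat -> V * R) :
  `|x| <= 1 -> (forall i, 0 < r i) ->
  (forall i u, U i u -> `|u - c i| <= r i) ->
  (forall t, `|t| <= L -> exists i, U i (a + t *: x, t)) ->
  exists j, forall t, `|t| <= L -> forall u, `|u - (a + t *: x, t)| <= j.+1%:R^-1 ->
    exists2 i, (i < j)%N & `|u - c i| <= 2 * r i.
Proof.
move=> x1 r0 Uc cov.
pose P (j : nat) (t : R) := forall u, `|u - (a + t *: x, t)| <= j.+1%:R^-1 ->
    exists2 i, (i < j)%N & `|u - c i| <= 2 * r i.
have /compact_near_coveringP/(_ nat \oo P _) := @segment_compact R (- L) L.
have PL (t : R) : `[- L, L]%classic t <-> `|t| <= L.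
  by rewrite /= in_itv /= ler_norml.
case=> [t /PL/cov[i Ui]|N _ hN].
  have r2 : 0 < r i / 2 by rewrite divr_gt0.
  have [M _ hM] := near_infty_natSinv_lt (PosNum r2).
  exists (ball t (r i / 2), [set j | (maxn M i.+1 <= j)%N]).
    by split; [exact: nbhsx_ballx|exact: nbhs_infty_ge].
  move=> [t' j] /= [tt']; rewrite geq_max => /andP[Mj ij] u hu; exists i => //.
  have hj := hM j Mj; rewrite /= in hj.
  have h1 : `|(a + t' *: x, t') - (a + t *: x, t)| <= r i / 2.
    move: tt'; rewrite /ball /= => /ltW; rewrite distrC => tt'.
    apply/prod_norm_leP; split=> //=.
    rewrite opprD addrACA subrr add0r -scalerBl normrZ.
    by rewrite (le_trans _ tt')// ler_piMr.
  apply: (le_trans (ler_distD (a + t' *: x, t') _ _)).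
  have -> : 2 * r i = r i / 2 + (r i / 2 + r i) by field.
  rewrite lerD//; first exact: le_trans hu (ltW hj).
  apply: (le_trans (ler_distD (a + t *: x, t) _ _)).
  by rewrite lerD//; exact: Uc.
exists N => t /PL; exact: (hN N (leqnn N)).

Qed.

(** The set E is applied through shears.  A box of radius 2 r i meets the relevant
    heights in a bounded part, so its images under the shears by e and e'
    with |e - e'| <= C * 2 r i are close, and the E' covering E at scale 2 r i gives
    the number of boxes needed for all of them.  The bound A on the position of
    the segments is preserved, because shears fix the points of height 0; the
    nested construction needs A to be independent of e. *)
Lemma thin_tubes (s0 s : R) : 0 < s0 -> s0 < s ->
  exists2 sigma : R, 0 < sigma /\ ((0 < m)%N -> sigma < m%:R) &
  forall (L A : R) (S : set (V * R)) (X : set V), 0 <= L ->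
    X !=set0 -> (forall x, X x -> `|x| <= 1) -> ((0 < m)%N -> ~ null ndist sigma X) ->
    null ndist s0 S ->
    (forall x, X x -> exists2 a, `|a| <= A & forall t, `|t| <= L -> S (a + t *: x, t)) ->
  forall e, 0 < e -> exists W : set (V * R), exists2 h : R, 0 < h &
    [/\ closed W, box_cover s e W & has_tubes L A h W].
Proof.
move=> s0_gt0 s0s; have s_gt0 := lt_trans s0_gt0 s0s.
have tau0 : 0 < s - s0 by rewrite subr_gt0.
have [sigma hsigma cov] := @sumset_cover R m _ tau0; exists sigma => //.
move=> L A S X L0 X0 X1 nX nS XS e e0.
have [C C1 {}cov] := cov X X0 X1 nX.
have C0 : 0 < C by apply: lt_le_trans C1.
pose D := 1 + C + (L + 2) * C.
have D0 : 0 < D by rewrite /D; nra.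
(* D is the distortion of a box by the shears, and kap * r `^ s0 the total cost
   of the boxes which replace a set of radius r. *)
pose kap := C * D `^ s * 2 `^ s0.
have kap0 : 0 < kap by rewrite /kap !mulr_gt0// powR_gt0.
(* The first bound ensures that 2 * r i <= 1, as the covering numbers require. *)
pose e1 := Num.min (2^-1 `^ s0) (e / kap).
have e10 : 0 < e1 by rewrite /e1 lt_min powR_gt0//= divr_gt0.
have [U [r [SU r0 dU sumr]]] := nS _ e10.
have r_half i : 0 < 2 * r i <= 1.
  rewrite mulr_gt0//= mulrC -ler_pdivlMr// mul1r.
  have h : r i `^ s0 <= 2^-1 `^ s0.
    have := sumr i.+1; rewrite big_ord_recr /= le_min => /andP[+ _]; apply: le_trans.
    by rewrite lerDr sumr_ge0// => j _; exact: powR_ge0.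
  have := powR_le_root (ltW (r0 i)) (powR_ge0 _ _) s0_gt0 h.
  by rewrite powR_root ?gt_eqF.
pose c i := xget 0 (U i).
have Uc i u : U i u -> `|u - c i| <= r i.
  by move=> Uu; apply: (dU i) => //; apply: xgetPex; exists u.
pose tube_in a x j := forall t, `|t| <= L -> forall u, `|u - (a + t *: x, t)| <= j.+1%:R^-1 ->
    exists2 i, (i < j)%N & `|u - c i| <= 2 * r i.
pose Y j := [set x | X x /\ exists2 a, `|a| <= A & tube_in a x j].
have [||x Xx|j {}cov] := cov Y.
- move=> i j ij x [Xx [a aA ha]]; split=> //; exists a => // t tL u hu.
  have [|l li ?] := ha t tL u; last by exists l => //; exact: leq_trans ij.
  by apply: (le_trans hu); rewrite lef_pV2 ?posrE// ler_nat ltnS.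
- by move=> j x [].
- have [a aA ha] := XS x Xx.
  have [|j hj] := @segment_uniform_cover a x L U r c (X1 _ Xx) r0 Uc.
    by move=> t /ha/SU[i _ ?]; exists i.
  by exists j => //; split=> //; exists a.
pose k : R := j.+1%:R^-1.
have k0 : 0 < k by rewrite invr_gt0.
have k1 : k <= 1 by rewrite invf_le1// ler1n.
(* The margin k is shared between the width h of the new tubes and the error d
   in the slopes. *)
pose h := k / (2 * (1 + C)); pose d := k / (2 * (L + 1)).
have h0 : 0 < h by rewrite divr_gt0//; lra.
have d0 : 0 < d by rewrite divr_gt0//; lra.
have hE : h * (1 + C) = k / 2 by rewrite /h; field; rewrite gt_eqF//; lra.
have dE : d * (L + 1) = k / 2 by rewrite /d; field; rewrite gt_eqF//; lra.
have [E [EC smallE] hitE] := cov d d0.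
have /(_ _)/cid2-/all_sig2[E' sE' EE'] := fun i => smallE _ (r_half i).
pose shear (e : V) (u : V * R) : V * R := (u.1 + u.2 *: e, u.2).
pose bs := flatten [seq [seq (shear e' (c i), D * (2 * r i)) | e' <- E' i] | i <- iota 0 j].
exists (boxes bs), h => //; split; first exact: closed_boxes.
  exists bs; split=> //.
    move=> b /flattenP[_ /mapP[i _ ->] /mapP[e' _ ->]] /=.
    by rewrite mulr_gt0//; case/andP: (r_half i).
  rewrite big_flatten /= big_map.
  apply: (@le_trans _ _ (\sum_(i <- iota 0 j) kap * r i `^ s0)).
    apply: ler_sum => i _; rewrite big_map /= sum_seq_const.
    have /andP[ri0 ri1] := r_half i.
    apply: (@le_trans _ _ (C * (2 * r i) `^ (- (s - s0)) * (D * (2 * r i)) `^ s)).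
      by rewrite ler_wpM2r ?powR_ge0.
    rewrite (powRM s (ltW D0) (ltW ri0)) mulrACA.
    rewrite -powRD; last by rewrite (gt_eqF ri0) implybT.
    by rewrite opprB subrK powRM ?(ltW (r0 i))// mulrA.
  rewrite -mulr_sumr -{1}(subn0 j) -/(index_iota 0 j) big_mkord.
  rewrite mulrC -ler_pdivlMr// (le_trans (sumr j))// /e1.
  by rewrite ge_min lexx orbT.
move=> x /hitE[e' e'E [v [Xv [a aA ha]] hv]]; exists a => // t tL u.
move=> /prod_norm_leP[/= u1 u2].
have e'C := EC _ e'E.
have [] := ha t tL (shear (- e') u).
  apply/prod_norm_leP; split=> /=; last by rewrite (le_trans u2)// -/k; nra.
  rewrite (_ : u.1 + _ - _ = (u.1 - (a + t *: x)) + t *: (x - e' - v) - (u.2 - t) *: e').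
    rewrite (le_trans (ler_normB _ _))// !normrZ.
    apply: (@le_trans _ _ (h + L * d + h * C)); last by rewrite -/k; nra.
    rewrite lerD ?ler_pM// (le_trans (ler_normD _ _))// normrZ lerD// ler_pM//.
  rewrite !scalerBr !scalerBl !scalerN !opprD !opprK !addrA.
  by apply/rowP => l; rewrite !mxE; ring.
move=> i ij /prod_norm_leP[/= w1 w2].
have [e2 e2E' e2C] := EE' i _ e'E.
exists (shear e2 (c i), D * (2 * r i)).
  apply/flattenP; eexists; first by apply/mapP; exists i; first by rewrite mem_iota.
  by apply/mapP; exists e2.
have /andP[ri0 ri1] := r_half i.
apply/prod_norm_leP; split=> /=; last first.
  by rewrite (le_trans w2)// ler_peMl ?(ltW ri0)// /D; nra.
rewrite (_ : u.1 - _ = (u.1 - u.2 *: e' - (c i).1) + (u.2 - (c i).2) *: e' + (c i).2 *: (e' - e2)).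
  apply: (@le_trans _ _ (2 * r i + 2 * r i * C + (L + 2) * (C * (2 * r i)))).
    rewrite (le_trans (ler_normD _ _))// !normrZ lerD//.
      rewrite (le_trans (ler_normD _ _))// normrZ lerD//; last by rewrite ler_pM.
      by rewrite -scalerN.
    rewrite ler_pM//.
    have h1 : h <= 1 by nra.
    have := ler_distD u.2 (c i).2 0; have := ler_distD t u.2 0.
    by rewrite !subr0 (distrC (c i).2); lra.
  by rewrite le_eqVlt; apply/orP; left; apply/eqP; rewrite /D; ring.
by apply/rowP => l; rewrite !mxE; ring.
Qed.

End Tubes.

(** * The nested construction *)

Lemma dependent_sequence (T : Type) (inv : nat -> T -> Prop) (rel : nat -> T -> T -> Prop) x0 :
  inv 0%N x0 -> (forall l x, inv l x -> exists2 y, inv l.+1 y & rel l x y) ->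
  exists f : nat -> T, [/\ f 0%N = x0, forall l, inv l (f l) & forall l, rel l (f l) (f l.+1)].
Proof.
move=> i0 step.
have /cid[nxt hn] : exists nxt : nat -> T -> T, forall l x, inv l x ->
    inv l.+1 (nxt l x) /\ rel l x (nxt l x).
  have : forall lx : nat * T, exists y, inv lx.1 lx.2 -> inv lx.1.+1 y /\ rel lx.1 lx.2 y.
    move=> [l x] /=; have [/step[y iy ry]|ni] := pselect (inv l x); first by exists y.
    by exists x.
  by move=> /choice[g hg]; exists (fun l x => g (l, x)) => l x; exact: (hg (l, x)).
pose f := fix f l := if l is l'.+1 then nxt l' (f l') else x0.
have fi l : inv l (f l) by elim: l => [//|l IH]; case: (hn _ _ IH).
by exists f; split=> // l; case: (hn _ _ (fi l)).
Qed.

Lemma continuous_pair (T U W : topologicalType) (f : T -> U) (g : T -> W) :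
  continuous f -> continuous g -> continuous (fun x => (f x, g x)).
Proof.
move=> cf cg x.
exact: (@cvg_pair _ _ _ (nbhs x) (nbhs (f x)) (nbhs (g x)) _ _ _ f g (cf x) (cg x)).
Qed.

Lemma closed_seq_union (T : topologicalType) (I : eqType) (s : seq I) (f : I -> set T) :
  (forall i, i \in s -> closed (f i)) -> closed [set x | exists2 i, i \in s & f i x].
Proof.
elim: s => [|i s IH] cl.
  rewrite (_ : [set _ | _] = set0); first exact: closed0.
  by apply/seteqP; split=> x // [].
rewrite (_ : [set _ | _] = f i `|` [set x | exists2 i, i \in s & f i x]).
  by apply: closedU; [apply: cl; rewrite mem_head|apply: IH => j js; apply: cl; rewrite inE js orbT].
apply/seteqP; split=> x /=.
  by move=> [j]; rewrite inE => /predU1P[->|js h]; [left|right; exists j].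
by move=> [h|[j js h]]; [exists i; rewrite ?mem_head|exists j; rewrite // inE js orbT].
Qed.

Section Nested.
Context {R : realType} {m : nat}.
Local Notation V := 'rV[R]_m.
Notation ndist := (fun x y => `|x - y|).

(** The lower corners of the N^m cubes of side 2 / N. *)
Lemma ball_net N : (0 < N)%N -> exists Z : seq V,
  [/\ size Z = (N ^ m)%N, forall z, z \in Z -> `|z| <= 1 &
      forall x : V, `|x| <= 1 -> exists2 z, z \in Z & `|x - z| <= 2 / N%:R].
Proof.
move=> N0; have N0' : 0 < N%:R :> R by rewrite ltr0n.
pose pt (f : {ffun 'I_m -> 'I_N}) : V := \row_j (-1 + 2 * (f j : nat)%:R / N%:R).
exists [seq pt f | f : {ffun 'I_m -> 'I_N}]; split.
- by rewrite size_map -cardE card_ffun !card_ord.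
- move=> _ /mapP[f _ ->]; apply/rV_norm_leP => // j; rewrite mxE ler_norml.
  have h0 : 0 <= (f j : nat)%:R / N%:R :> R by rewrite divr_ge0.
  have h1 : (f j : nat)%:R / N%:R <= 1 :> R by rewrite ler_pdivrMr// mul1r ler_nat ltnW.
  by rewrite -mulrA; apply/andP; split; lra.
move=> x /rV_norm_leP x1.
have lt (j : 'I_m) : (minn N.-1 (Num.truncn ((x 0 j + 1) * N%:R / 2)%R) < N)%N.
  by rewrite gtn_min ltn_predL N0.
exists (pt [ffun j => Ordinal (lt j)]); first by apply/mapP; exists [ffun j => Ordinal (lt j)]; rewrite ?mem_enum.
apply/rV_norm_leP; first by rewrite divr_ge0// ltW.
move=> j; rewrite !mxE ffunE /=.
have := x1 ler01 j; rewrite ler_norml => /andP[xj0 xj1].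
set y := (x 0 j + 1) * N%:R / 2.
have y0 : 0 <= y by rewrite /y divr_ge0// mulr_ge0//; lra.
have yN : y <= N%:R by rewrite /y; nra.
have /andP[t0 t1] := truncn_itv y0.
have key : `|y - (minn N.-1 (Num.truncn y))%:R| <= 1.
  rewrite ler_norml; case: (leqP N.-1 (Num.truncn y)) => h.
    have : N%:R = N.-1%:R + 1 :> R by rewrite natr1 prednK.
    have : N.-1%:R <= (Num.truncn y)%:R :> R by rewrite ler_nat.
    by move=> *; apply/andP; split; lra.
  by rewrite -natr1 in t1; apply/andP; split; lra.
rewrite (_ : x 0 j - _ = 2 / N%:R * (y - (minn N.-1 (Num.truncn y))%:R)).
  by rewrite normrM ger0_norm ?divr_ge0 ?(ltW N0')// ler_piMr// divr_ge0// ltW.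
by rewrite /y; field; rewrite gt_eqF.
Qed.

Lemma ball_fine_net (lam : R) : 0 < lam -> exists Z : seq V,
  (forall z, z \in Z -> `|z| <= 1) /\
  forall x : V, `|x| <= 1 -> exists2 z, z \in Z & `|x - z| <= lam.
Proof.
move=> lam0; pose N := (Num.truncn (2 / lam)).+1.
have [//|Z [_ Z1 hZ]] := @ball_net N.
exists Z; split=> // x /hZ[z zZ h]; exists z => //; apply: (le_trans h).
have /truncn_itv/andP[_ /ltW hN] : 0 <= 2 / lam by rewrite divr_ge0// ltW.
by rewrite ler_pdivrMr ?ltr0n// mulrC -ler_pdivrMr.
Qed.

Lemma box_cover_content (s c d : R) (W : set (V * R)) : 0 < s -> 0 < d ->
  box_cover s c W -> content_le ndist s (2 `^ s * c + d) W.
Proof.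
move=> s0 d0 [bs [b0 Wbs cost]].
pose cs := [seq ([set u : V * R | `|u - b.1| <= b.2], 2 * b.2) | b <- bs].
apply: (@content_mono _ _ _ _ (\sum_(b <- cs) b.2 `^ s + d)).
  rewrite lerD2r big_map /= big_seq.
  under eq_bigr => b bbs do rewrite powRM ?(ltW (b0 _ bbs))//.
  by rewrite -mulr_sumr -big_seq ler_pM2l// powR_gt0.
apply: (@content_sub _ _ _ _ _ _ [set x | exists2 b, b \in cs & b.1 x]).
  move=> u /Wbs[b bbs h]; exists ([set u | `|u - b.1| <= b.2], 2 * b.2) => //.
  by apply/mapP; exists b.
apply: content_list => //.
  by move=> _ /mapP[b /b0 ? ->]; rewrite /= mulr_gt0.
move=> _ /mapP[b _ ->] x y /= hx hy; rewrite (le_trans (ler_distD b.1 _ _))//.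
by rewrite (distrC b.1) mulr_natl mulr2n lerD.
Qed.

Lemma box_cover_exponent (s s' e : R) (W : set (V * R)) : 0 < s -> s <= s' -> e <= 1 ->
  box_cover s e W -> box_cover s' e W.
Proof.
move=> s0 ss' e1 [bs [b0 Wbs cost]]; exists bs; split=> //; apply: (le_trans _ cost).
have : forall b, b \in bs -> b.2 <= 1.
  move=> b bbs; apply: (powR_le1 (ltW (b0 _ bbs)) s0).
  apply: (le_trans _ e1); apply: (le_trans _ cost).
  by rewrite (big_rem b)//= lerDl sumr_ge0// => *; exact: powR_ge0.
move=> b1; rewrite big_seq [leRHS]big_seq; apply: ler_sum => b bbs.
by apply: ger_powR => //; rewrite b0//= b1.
Qed.

Definition tubes (L h : R) (W : set (V * R)) :=
  forall x : V, `|x| <= 1 -> exists a : V,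
    forall t, `|t| <= L -> forall u, `|u - (a + t *: x, t)| <= h -> W u.

(** The bound A is fixed before e, so that [refine_tubes] can first choose the number
    of its copies from A and then their cost. *)
Definition thin_at (s : R) := forall L : R, 0 <= L -> exists A : R, forall e, 0 < e ->
  exists W : set (V * R), exists2 h : R, 0 < h &
    [/\ closed W, box_cover s e W & has_tubes L A h W].

(** The map phi z compresses the x direction by lam and shears by z, and so sends
    slope x' to z + lam x'.  The copies for the slopes z of a lam-net thus have
    tubes of all slopes, and each is close to the tube of W of slope z because
    lam (A + L') is small.  The number of copies depends on lam only, hence it is
    known before the cost of W0 is prescribed. *)
Lemma refine_tubes (s e L L' h : R) (W : set (V * R)) : 0 <= L' -> 0 < e -> 0 < h ->
  thin_at s -> tubes L h W ->
  exists W' : set (V * R), exists2 h', 0 < h' &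
    [/\ closed W', box_cover s e W', tubes L' h' W' &
        forall u, W' u -> `|u.2| <= L -> W u].
Proof.
move=> L'0 e0 h0 /(_ _ L'0)[A' thin] tubesW.
pose A := Num.max A' 0.
have A0 : 0 <= A by rewrite le_max lexx orbT.
pose lam := Num.min 1 (h / (2 * (A + L' + 1))).
have lam0 : 0 < lam by rewrite lt_min ltr01 divr_gt0//; lra.
have lam1 : lam <= 1 by rewrite ge_min lexx.
have lamh : lam * (A + L') <= h / 2.
  have : lam <= h / (2 * (A + L' + 1)) by rewrite ge_min lexx orbT.
  rewrite ler_pdivlMr; last by lra.
  nra.
have [Z [Z1 netZ]] := ball_fine_net lam0.
have /choice[a ha] : forall z : V, exists a : V, `|z| <= 1 ->
    forall t, `|t| <= L -> forall u, `|u - (a + t *: z, t)| <= h -> W u.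
  move=> z; have [z1|nz1] := pselect (`|z| <= 1); last by exists 0.
  by have [a ha] := tubesW z z1; exists a.
pose e1 := e / ((size Z).+1%:R * 2 `^ s).
have k0 : 0 < (size Z).+1%:R * 2 `^ s :> R by rewrite mulr_gt0// powR_gt0.
have e10 : 0 < e1 by rewrite divr_gt0.
have [W0 [h1 h10 [clW0 [bs [bs0 W0bs cost]] tubesW0]]] := thin e1 e10.
pose psi z (u : V * R) : V * R := (lam^-1 *: (u.1 - a z - u.2 *: z), u.2).
pose phi z (u : V * R) : V * R := (a z + u.2 *: z + lam *: u.1, u.2).
pose W' := [set u : V * R | exists2 z, z \in Z &
  (psi z @^-1` W0) u /\ `|u.1 - a z - u.2 *: z| <= h].
pose h' := Num.min (lam * h1 / 2) (h / 4).
have h'0 : 0 < h' by rewrite lt_min !divr_gt0// mulr_gt0.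
have h'h : h' <= h / 4 by rewrite ge_min lexx orbT.
have h'h1 : h' <= lam * h1 / 2 by rewrite ge_min lexx.
have cont z : continuous (fun u : V * R => u.1 - a z - u.2 *: z).
  move=> u; apply: cvgB; first by apply: cvgB; [exact: cvg_fst|exact: cvg_cst].
  by apply: cvgZr_tmp; exact: cvg_snd.
exists W', h' => //; split.
- apply: closed_seq_union => z zZ.
  apply: (@closedI _ (psi z @^-1` W0) [set u | `|u.1 - a z - u.2 *: z| <= h]).
    apply: preimage_closed clW0 => u _; apply: continuous_pair => {}u; last exact: cvg_snd.
    by apply: cvgZl_tmp; exact: cont.
  apply: (@preimage_closed _ _ (fun u : V * R => `|u.1 - a z - u.2 *: z|) [set x : R | x <= h]); last exact: closed_le.
  by move=> u _; apply: cvg_norm; exact: cont.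
- exists [seq (phi z b.1, 2 * b.2) | z <- Z, b <- bs]; split.
  + by move=> _ /allpairsP[[z b] [/= _ /bs0 b0 ->]]; rewrite /= mulr_gt0.
  + move=> u [z zZ [/W0bs[b bbs hb] _]].
    exists (phi z b.1, 2 * b.2); first by apply/allpairsP; exists (z, b).
    move: hb => /prod_norm_leP[/= hb1 hb2]; have b0 := bs0 _ bbs.
    apply/prod_norm_leP; split=> /=; last by rewrite (le_trans hb2)//; lra.
    rewrite (_ : u.1 - _ = (u.2 - b.1.2) *: z +
        lam *: (lam^-1 *: (u.1 - a z - u.2 *: z) - b.1.1)); last first.
      rewrite scalerBr scalerA divff ?gt_eqF// scale1r scalerBl.
      by apply/rowP => l; rewrite !mxE; ring.
    rewrite (le_trans (ler_normD _ _))// !normrZ mulr_natl mulr2n lerD//.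
      by rewrite -[leRHS]mulr1 ler_pM// Z1.
    by rewrite -[leRHS]mul1r ler_pM// ger0_norm// ltW.
  + rewrite big_allpairs_dep /= sum_seq_const.
    rewrite big_seq; under eq_bigr => b bbs do rewrite powRM ?(ltW (bs0 _ bbs))//.
    rewrite -mulr_sumr -big_seq mulrA.
    apply: (@le_trans _ _ ((size Z).+1%:R * 2 `^ s * e1)).
      apply: ler_pM => //.
        by rewrite sumr_ge0// => *; exact: powR_ge0.
      by rewrite ler_wpM2r ?powR_ge0// ler_nat.
    by rewrite /e1 mulrC divfK ?gt_eqF.
- move=> x /netZ[z zZ xz].
  have z1 := Z1 _ zZ.
  pose x' := lam^-1 *: (x - z).
  have x'1 : `|x'| <= 1.
    by rewrite normrZ gtr0_norm ?invr_gt0// mulrC ler_pdivrMr// mul1r.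
  have xE : x = z + lam *: x'.
    by rewrite /x' scalerA divff ?gt_eqF// scale1r addrC subrK.
  have [a' a'A ha'] := tubesW0 x' x'1.
  exists (a z + lam *: a') => t tL' u /prod_norm_leP[/= u1 u2].
  exists z => //.
  set dx := u.1 - _ in u1.
  have uE : u.1 - a z - u.2 *: z = (dx - (u.2 - t) *: z) + lam *: (a' + t *: x').
    rewrite /dx xE; apply/rowP => l; rewrite !mxE; ring.
  have dxh : `|dx - (u.2 - t) *: z| <= 2 * h'.
    rewrite (le_trans (ler_normB _ _))// mulr_natl mulr2n lerD// normrZ.
    by rewrite -[leRHS]mulr1 ler_pM.
  split.
    apply: (ha' t tL'); apply/prod_norm_leP; split=> /=; last by rewrite (le_trans u2)//; nra.
    rewrite uE scalerDr scalerA mulVf ?gt_eqF// scale1r addrK normrZ gtr0_norm ?invr_gt0//.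
    by rewrite mulrC ler_pdivrMr// (le_trans dxh)//; lra.
  rewrite uE (le_trans (ler_normD _ _))//.
  have : `|lam *: (a' + t *: x')| <= lam * (A + L').
    rewrite normrZ (gtr0_norm lam0) ler_pM2l// (le_trans (ler_normD _ _))// lerD//.
      by rewrite (le_trans a'A)// le_max lexx.
    by rewrite normrZ -[leRHS]mulr1 ler_pM.
  by move: dxh; lra.
move=> u [z zZ [_ hz]] uL; apply: (ha z (Z1 _ zZ) u.2 uL).
by apply/prod_norm_leP; rewrite /= subrr normr0 opprD addrA; split=> //; exact: ltW.
Qed.


(** At stage l the tubes have heights up to l + 1, and later stages only shrink
    the part below that height.  The half-spaces beyond it are added so that the
    intersection can contain full lines. *)
Lemma line_set (d : R) : 0 <= d -> (forall s, d < s -> thin_at s) ->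
  exists F : set (V * R),
    [/\ closed F, forall s, d < s -> null ndist s F &
        forall x, `|x| <= 1 -> exists2 a, `|a| <= 3 & forall t, F (a + t *: x, t)].
Proof.
move=> d0 thin.
pose inv l (Wh : set (V * R) * R) :=
  [/\ closed Wh.1, 0 < Wh.2 & tubes l.+1%:R Wh.2 Wh.1].
pose rel l (Wh Wh' : set (V * R) * R) :=
  box_cover (d + l.+1%:R^-1) l.+1%:R^-1 Wh'.1 /\
  forall u, Wh'.1 u -> `|u.2| <= l.+1%:R -> Wh.1 u.
have [||f [f0 finv frel]] := @dependent_sequence _ inv rel ([set u | `|u - 0| <= 3], 1).
- split=> //=; first exact: closed_box.
  move=> x x1; exists 0 => t t1 u /prod_norm_leP[/= h1 h2].
  rewrite add0r in h1.
  have := ler_normD (u.1 - t *: x) (t *: x); have := ler_normD (u.2 - t) t.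
  rewrite !subrK normrZ => h3 h4.
  have : `|t| * `|x| <= 1 by rewrite -[leRHS]mulr1 ler_pM.
  move=> h5; rewrite subr0; apply/prod_norm_leP; split.
    by apply: (le_trans h4); lra.
  by apply: (le_trans h3); lra.
- move=> l [W h] [clW h0 tW].
  have lp : 0 < l.+1%:R^-1 :> R by rewrite invr_gt0.
  have [||W' [h' h'0 [clW' cov tW' sub]]] := @refine_tubes (d + l.+1%:R^-1)
    l.+1%:R^-1 l.+1%:R l.+2%:R h W _ lp h0 _ tW => //.
    by apply: thin; rewrite ltrDl.
  by exists (W', h').
pose W l := (f l).1.
have nest k l u : (l <= k)%N -> `|u.2| <= l.+1%:R -> W k u -> W l u.
  move=> lk ul; elim: k lk => [|k IH]; first by rewrite leqn0 => /eqP ->.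
  rewrite leq_eqVlt ltnS => /predU1P[->//|lk] Wu; apply: IH => //.
  have [_] := frel k; apply=> //; apply: (le_trans ul).
  by rewrite ler_nat ltnS.
pose F := [set u : V * R | forall l, l.+1%:R <= `|u.2| \/ W l u].
exists F; split.
- rewrite (_ : F = \bigcap_l ([set u : V * R | l.+1%:R <= `|u.2|] `|` W l)); last first.
    by apply/seteqP; split=> u Fu l; [move=> _; exact: Fu|exact: (Fu l I)].
  apply: closed_bigI => l _; apply: closedU; last by case: (finv l).
  apply: (@preimage_closed _ _ (fun u : V * R => `|u.2|) [set x : R | l.+1%:R <= x]); last exact: closed_ge.
  by move=> u _; apply: cvg_norm; exact: cvg_snd.
- move=> s ds; have s0 := le_lt_trans d0 ds.
  apply: (@null_sub _ _ _ _ _ (\bigcup_l (F `&` [set u | `|u.2| < l.+1%:R]))).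
    move=> u Fu; exists (Num.truncn `|u.2|) => //; split=> //=.
    by have /andP[] := truncn_itv (normr_ge0 u.2).
  apply: null_bigcup => l e e0.
  pose c := Num.min (s - d) (Num.min 1 (e / (2 * 2 `^ s))).
  have q0 : 0 < 2 * 2 `^ s :> R by rewrite mulr_gt0// powR_gt0.
  have c0 : 0 < c by rewrite !lt_min subr_gt0 ds ltr01 divr_gt0.
  have [M _ hM] := near_infty_natSinv_lt (PosNum c0).
  pose k := maxn M l.
  have := hM k (leq_maxl _ _); rewrite /= !lt_min => /and3P[k1 k2 k3].
  have [cov _] := frel k.
  have {}cov : box_cover s k.+1%:R^-1 (W k.+1).
    apply: box_cover_exponent cov; last exact: ltW.
      by rewrite ltr_wpDl// invr_gt0.
    by rewrite -lerBrDl ltW.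
  have e2 : 0 < e / 2 by rewrite divr_gt0.
  apply: (@content_mono _ _ _ _ (2 `^ s * k.+1%:R^-1 + e / 2)).
    move: k3; rewrite ltr_pdivlMr// mulrCA [X in _ * X]mulrC => /ltW.
    by move: (_ `^ _ * _) => z; lra.
  apply: content_sub (box_cover_content s0 e2 cov) => u [Fu /= ul].
  have [h|//] := Fu k.+1.
  have lk : l.+1%:R <= k.+2%:R :> R by rewrite ler_nat ltnS leqW// leq_maxr.
  by have := lt_le_trans ul (le_trans lk h); rewrite ltxx.
- move=> x x1.
  pose A l := [set a : V | `|a| <= 3 /\ forall t, `|t| <= l.+1%:R -> W l (a + t *: x, t)].
  have clA l : closed (A l).
    rewrite (_ : A l = [set a : V | `|a| <= 3] `&`
       \bigcap_(t in [set t : R | `|t| <= l.+1%:R]) ((fun a : V => (a + t *: x, t)) @^-1` W l)); last first.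
      by apply/seteqP; split=> a [? h]; split.
    apply: closedI.
      apply: (@preimage_closed _ _ (fun a : V => `|a|) [set x : R | x <= 3]); last exact: closed_le.
      by move=> a _; exact: norm_continuous.
    apply: closed_bigI => t _; have [clW _ _] := finv l.
    apply: preimage_closed clW => a _; apply: continuous_pair => {}a; last exact: cst_continuous.
    apply: (@cvgD _ V _ (nbhs a) _ (fun a => a) (fun=> t *: x)); [exact: cvg_id|exact: cvg_cst].
  have /choice[a ha] : forall l, exists a, A l a.
    move=> l; have [_ h0 /(_ x x1)[a ha]] := finv l.
    have aW t : `|t| <= l.+1%:R -> W l (a + t *: x, t).
      by move=> /ha; apply; rewrite subrr normr0 ltW.
    exists a; split=> //.
    have : W 0%N (a + 0 *: x, 0).
      by apply: (nest l) => //; rewrite ?normr0//; apply: aW; rewrite normr0.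
    by rewrite /W f0 /= scale0r addr0 subr0 => /prod_norm_leP[].
  have sub k l : (l <= k)%N -> A l (a k).
    move=> lk; have [ak hk] := ha k; split=> // t tl.
    by apply: (nest k) => //; apply: hk; rewrite (le_trans tl)// ler_nat.
  have cK : compact (A 0%N).
    apply: bounded_closed_compact; last exact: clA.
    by exists 3; split=> // y y3 b [/le_trans h _]; apply: h; exact: ltW.
  have [|b [_ clb]] := cK (a k @[k --> \oo]) _; first by exists 0%N => // k _; exact: sub.
  have Ab l : A l b.
    apply: clA; move: clb; rewrite clusterE; apply; exists l => // k /= lk; exact: sub.
  exists b; first by case: (Ab 0%N).
  move=> t l; have [?|/ltW tl] := leP l.+1%:R `|t|; [by left|right].
  by have [_] := Ab l; apply.
Qed.

End Nested.

(** * Angles and slopes *)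

Section SineBounds.
Context {R : realType}.
Implicit Type x : R.

Lemma sin_mvt x : 0 <= x -> exists2 c, 0 <= c <= x & sin x = cos c * x.
Proof.
move=> x0; have dsin (c : R) : c \in `]0, x[ -> is_derive c 1 sin (cos c).
  by move=> _; exact: is_derive_sin.
have [|c + h] := @MVT_segment R sin cos 0 x x0 dsin.
  by apply: continuous_subspaceT => y; exact: continuous_sin.
by rewrite in_itv /= => cx; exists c => //; move: h; rewrite sin0 !subr0.
Qed.

Lemma sin_le_id x : 0 <= x -> sin x <= x.
Proof. by move=> x0; have [c _ ->] := sin_mvt x0; rewrite ler_piMl// cos_le1. Qed.

(** cos x = 1 - 2 sin (x/2)^2. *)
Lemma cos_ge_half x : 0 <= x <= 1 -> 2^-1 <= cos x.
Proof.
move=> /andP[x0 x1]; have x20 : 0 <= x / 2 by rewrite divr_ge0.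
have -> : x = (x / 2) *+ 2 by rewrite -mulr_natr divfK// pnatr_eq0.
rewrite cos_mulr2n cos2sin2.
have := sin_le_id x20.
have : 0 <= sin (x / 2).
  by apply: sin_ge0_pi; rewrite x20/= (le_trans _ (pi_ge2 R))//; lra.
move=> h1 h2; have : sin (x / 2) ^+ 2 <= 2^-1 * 2^-1.
  by rewrite expr2 ler_pM//; lra.
move: (sin _ ^+ 2) => y hy; lra.
Qed.

(** sin x = 2 sin (x/2) cos (x/2), and x/2 <= pi/4 <= 1. *)
Lemma le_4sin x : 0 <= x <= pi / 2 -> x <= 4 * sin x.
Proof.
move=> /andP[x0 x1]; have x20 : 0 <= x / 2 by rewrite divr_ge0.
have x21 : x / 2 <= 1 by have := pihalf_lt2 R; lra.
have -> : sin x = 2 * (cos (x / 2) * sin (x / 2)).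
  rewrite {1}(_ : x = (x / 2) *+ 2); last by rewrite -mulr_natr divfK// pnatr_eq0.
  by rewrite sin_mulr2n mulr2n; ring.
have c1 : 2^-1 <= cos (x / 2) by apply: cos_ge_half; rewrite x20.
have [c /andP[c0 cx] sE] := sin_mvt x20.
have c2 : 2^-1 <= cos c by apply: cos_ge_half; rewrite c0 (le_trans cx).
rewrite sE; have : (x / 2) / 2 <= cos c * (x / 2) by rewrite mulrC ler_wpM2r.
set y := cos c * _ => hy.
have : 2^-1 * y <= cos (x / 2) * y by rewrite ler_wpM2r//; lra.
lra.
Qed.

Lemma acos_sin_bounds (c : R) : 0 <= c <= 1 ->
  let s := Num.sqrt (1 - c ^+ 2) in s <= acos c <= 4 * s.
Proof.
move=> /andP[c0 c1] /=; have c1' : -1 <= c <= 1 by rewrite c1 andbT; lra.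
rewrite -sin_acos//.
have a0 := acos_ge0 c1'.
rewrite sin_le_id//= le_4sin// a0 /=.
rewrite leNgt; apply/negP => h.
have : cos (acos c) < 0.
  have e : acos c = (acos c - pi / 2) + pi / 2 by rewrite subrK.
  rewrite e cosDpihalf oppr_lt0; apply: sin_gt0_pihalf.
  rewrite subr_gt0 h/=.
  have := acos_lepi c1'; rewrite le_eqVlt => /predU1P[ap|]; last by lra.
  have := acosK; move=> /(_ R c); rewrite in_itv /= c1' => /(_ isT).
  by rewrite ap cospi => c1N; move: c0; rewrite -c1N; lra.
by rewrite acosK ?in_itv//= ltNge c0.
Qed.

End SineBounds.

Section Dot.
Context {R : realType} {n : nat}.
Implicit Types u v w : 'rV[R]_n.

Lemma dotE u v : dot u v = \sum_j u 0 j * v 0 j.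
Proof. by rewrite /dot mxE; apply: eq_bigr => j _; rewrite mxE. Qed.

Lemma dotC u v : dot u v = dot v u.
Proof. by rewrite !dotE; apply: eq_bigr => j _; rewrite mulrC. Qed.

Lemma dotBl u v w : dot (u - v) w = dot u w - dot v w.
Proof. by rewrite !dotE -sumrB; apply: eq_bigr => j _; rewrite !mxE mulrBl. Qed.

Lemma dotBr u v w : dot u (v - w) = dot u v - dot u w.
Proof. by rewrite dotC dotBl !(dotC u). Qed.

Lemma dot_ge0 u : 0 <= dot u u.
Proof. by rewrite dotE; apply: sumr_ge0 => j _; rewrite -expr2 sqr_ge0. Qed.

Lemma coord2_le_dot u j : u 0 j ^+ 2 <= dot u u.
Proof.
rewrite dotE (bigD1 j)//= -expr2 lerDl sumr_ge0// => i _.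
by rewrite -expr2 sqr_ge0.
Qed.

Lemma eucl_norm_ge0 u : 0 <= eucl_norm u. Proof. exact: sqrtr_ge0. Qed.

Lemma eucl_norm_sqr u : eucl_norm u ^+ 2 = dot u u.
Proof. by rewrite sqr_sqrtr// dot_ge0. Qed.

Lemma norm_dot_le u v : `|dot u v| <= eucl_norm u * eucl_norm v.
Proof.
rewrite -sqrtr_sqr -sqrtrM ?dot_ge0// ler_sqrt ?mulr_ge0 ?dot_ge0//.
have := dot_ge0 u; rewrite le_eqVlt => /predU1P[/esym u0|P0].
  have u00 j : u 0 j = 0.
    apply/eqP; rewrite -sqrf_eq0 -(le_anti (_ : u 0 j ^+ 2 <= 0 <= u 0 j ^+ 2))//.
    by rewrite -{1}u0 coord2_le_dot sqr_ge0.
  by rewrite u0 mul0r dotE big1 ?expr0n// => j _; rewrite u00 mul0r.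
have := dot_ge0 (v - (dot u v / dot u u) *: u).
rewrite dotBl !dotBr !dotZl !dotZr (dotC v u).
set P := dot u u in P0 *; set Q := dot v v; set S := dot u v.
rewrite (_ : _ - _ = (P * Q - S ^+ 2) / P); last by field; rewrite gt_eqF.
by rewrite pmulr_lge0 ?invr_gt0// subr_ge0.
Qed.

Lemma norm_le_eucl u : `|u| <= eucl_norm u.
Proof.
apply/rV_norm_leP; first exact: eucl_norm_ge0.
by move=> j; rewrite -sqrtr_sqr ler_sqrt ?dot_ge0// coord2_le_dot.
Qed.

Lemma eucl_le_norm u : eucl_norm u <= n%:R * `|u|.
Proof.
rewrite -ler_sqr ?nnegrE ?eucl_norm_ge0 ?mulr_ge0// eucl_norm_sqr dotE.
apply: (@le_trans _ _ (\sum_(j < n) `|u| ^+ 2)).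
  apply: ler_sum => j _; rewrite -expr2 -real_normK ?num_real//.
  by rewrite ler_sqr ?nnegrE// rV_norm_coord.
rewrite sumr_const card_ord exprMn -[leLHS]mulr_natl ler_wpM2r ?sqr_ge0// -natrX ler_nat.
by rewrite expnS expn1; case: (n) => // k; rewrite leq_pmulr.
Qed.

Lemma eucl_dist_ge0 u v : 0 <= eucl_dist u v. Proof. exact: eucl_norm_ge0. Qed.

End Dot.

Section AngleSlope.
Context {R : realType} {n : nat}.
Implicit Types u v : 'rV[R]_n.

(** With w the component of v orthogonal to u, the sine of the angle is |w| / |v|.
    The difference v - u is at least as long as w by minimality; conversely
    v - u = w - w_i u, because both vectors have i-th coordinate 1. *)
Lemma angle_bounds (i : 'I_n) (u v : 'rV[R]_n) : u 0 i = 1 -> v 0 i = 1 ->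
  `|u| <= 1 -> `|v| <= 1 ->
  let theta := acos (`|dot u v| / (eucl_norm u * eucl_norm v)) in
  [/\ 0 <= theta, `|u - v| <= 2 * n%:R * theta & theta <= 4 * n%:R * `|u - v|].
Proof.
move=> ui vi u1 v1 theta.
have n1 : 1 <= n%:R :> R by rewrite ler1n (leq_trans _ (ltn_ord i)).
set P := dot u u; set Q := dot v v; set S := dot u v.
have P1 : 1 <= P by have := coord2_le_dot u i; rewrite ui expr1n.
have Q1 : 1 <= Q by have := coord2_le_dot v i; rewrite vi expr1n.
have Qn : eucl_norm v <= n%:R by rewrite (le_trans (eucl_le_norm v))// ler_piMr.
have P0 : 0 < P by lra. have Q0 : 0 < Q by lra.
pose w := v - (S / P) *: u.
have wE : dot w w = Q - S ^+ 2 / P.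
  rewrite /w dotBl !dotBr !dotZl !dotZr -/P -/Q (dotC v u) -/S; field.
  by rewrite gt_eqF.
pose c := `|S| / (eucl_norm u * eucl_norm v).
have nu : 0 < eucl_norm u by rewrite sqrtr_gt0.
have nv : 0 < eucl_norm v by rewrite sqrtr_gt0.
have c0 : 0 <= c by rewrite divr_ge0// mulr_ge0// ltW.
have c2 : c ^+ 2 = S ^+ 2 / (P * Q).
  by rewrite /c expr_div_n exprMn !eucl_norm_sqr real_normK ?num_real.
have c2E : 1 - c ^+ 2 = dot w w / Q.
  by rewrite c2 wE; field; rewrite !gt_eqF.
have c1 : c <= 1 by rewrite ler_pdivrMr ?mulr_gt0// mul1r norm_dot_le.
have /andP[h1 h2] : Num.sqrt (1 - c ^+ 2) <= theta <= 4 * Num.sqrt (1 - c ^+ 2).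
  by apply: acos_sin_bounds; rewrite c0.
have sE : Num.sqrt (1 - c ^+ 2) = eucl_norm w / eucl_norm v.
  by rewrite c2E sqrtrM ?dot_ge0// sqrtrV// ltW.
rewrite sE in h1 h2.
have t0 : 0 <= theta by apply: le_trans h1; rewrite divr_ge0// ?eucl_norm_ge0// ltW.
split=> //.
  have wn : eucl_norm w <= n%:R * theta.
    rewrite ler_pdivrMr// in h1; rewrite (le_trans h1)// mulrC ler_wpM2r//.
  have wi j : `|w 0 j| <= n%:R * theta.
    by rewrite (le_trans _ wn)// (le_trans _ (norm_le_eucl w))// rV_norm_coord.
  apply/rV_norm_leP; first by rewrite !mulr_ge0.
  move=> j; have -> : (u - v) 0 j = w 0 i * u 0 j - w 0 j.
    by rewrite /w !mxE ui vi; ring.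
  rewrite (le_trans (ler_normB _ _))// normrM.
  have uj : `|u 0 j| <= 1 by rewrite (le_trans (rV_norm_coord _ _)).
  have := wi i; have := wi j; have : 0 <= `|w 0 i| by [].
  move: uj; set a := `|w 0 i|; set b := `|u 0 j| => uj *.
  have : a * b <= a by rewrite ler_piMr.
  lra.
apply: (le_trans h2); rewrite -mulrA ler_pM2l//.
have wle : eucl_norm w <= eucl_norm (u - v).
  rewrite ler_sqrt ?dot_ge0// wE dotBl !dotBr -/P -/Q (dotC v u) -/S.
  rewrite -subr_ge0 (_ : _ - _ = (P - S) ^+ 2 / P); last by field; rewrite gt_eqF.
  by rewrite divr_ge0 ?sqr_ge0// ltW.
rewrite ler_pdivrMr// (le_trans wle)// (le_trans (eucl_le_norm _))//.
rewrite ler_peMr ?mulr_ge0//.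
by rewrite -ler_sqr ?nnegrE ?eucl_norm_ge0// expr1n eucl_norm_sqr.
Qed.

End AngleSlope.

(** * The dimension of a box *)

Section Box.
Context {R : realType} {m : nat}.
Local Notation V := 'rV[R]_m.
Notation ndist := (fun x y => `|x - y|).
Let box : set V := [set x | `|x| <= 1].

(** N ^ m cubes of side 2 / N cost a constant times N ^ (m - s). *)
Lemma null_box (s : R) : m%:R < s -> null ndist s box.
Proof.
move=> ms e e0; have s0 : 0 < s by apply: le_lt_trans ms.
have sm : 0 < s - m%:R by rewrite subr_gt0.
pose y := 2 * 4 `^ s / e.
have y0 : 0 < y by rewrite /y divr_gt0// mulr_gt0// powR_gt0.
pose N := (Num.truncn (y `^ (s - m%:R)^-1)).+1.
have N0 : 0 < N%:R :> R by rewrite ltr0n.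
have hN : y <= N%:R `^ (s - m%:R).
  rewrite -{1}(root_powR (ltW y0) (lt0r_neq0 sm)).
  apply: ge0_ler_powR; rewrite ?nnegrE ?powR_ge0 ?(ltW N0) ?(ltW sm)//.
  by have /truncn_itv/andP[_ /ltW] := powR_ge0 y (s - m%:R)^-1.
have [//|Z [sZ _ hZ]] := @ball_net R m N.
pose cs := [seq ([set x : V | `|x - z| <= 2 / N%:R], 4 / N%:R : R) | z <- Z].
apply: (@content_mono _ _ _ _ (\sum_(b <- cs) b.2 `^ s + e / 2)).
  rewrite big_map /= sum_seq_const sZ natrX -powR_mulrn ?(ltW N0)//.
  rewrite powRM ?invr_ge0 ?(ltW N0)// -powR_inv1 ?(ltW N0)// -powRrM mulrCA -powRD; last first.
    by rewrite (gt_eqF N0) implybT.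
  rewrite mulN1r -(opprB s) powRN.
  have : 4 `^ s * (N%:R `^ (s - m%:R))^-1 <= e / 2.
    rewrite ler_pdivrMr ?powR_gt0//.
    move: hN; rewrite /y ler_pdivrMr//; set a := N%:R `^ _; set b := 4 `^ s; lra.
  set a := N%:R `^ _; lra.
apply: (@content_sub _ _ _ _ _ _ [set x | exists2 b, b \in cs & b.1 x]).
  move=> x /hZ[z zZ h]; exists ([set x | `|x - z| <= 2 / N%:R], 4 / N%:R) => //.
  by apply/mapP; exists z.
apply: content_list => //; first by rewrite divr_gt0.
  by move=> _ /mapP[z _ ->]; rewrite /= divr_gt0.
move=> _ /mapP[z _ ->] x x' /= hx hx'; rewrite (le_trans (ler_distD z _ _))//.
rewrite (distrC z) (_ : 4 / N%:R = 2 / N%:R + 2 / N%:R) ?lerD//.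
by field; rewrite gt_eqF.
Qed.

Lemma card_ord_near (M : nat) (z w : R) : 0 <= w ->
  #|[pred a : 'I_M | `|(a : nat)%:R - z| < w]|%:R <= 2 * w + 1.
Proof.
move=> w0; set A := [pred a : 'I_M | _].
case: (pickP A) => [a aA|A0]; last by rewrite (eq_card0 A0); lra.
case: (@arg_minnP _ a (mem A) (fun x : 'I_M => x : nat) aA) => a0 a0A mina.
have w20 : 0 <= 2 * w by lra.
have /andP[_ ht] := truncn_itv w20.
pose t := Num.truncn (2 * w).
apply: (@le_trans _ _ t.+1%:R); last first.
  by rewrite -natr1 lerD2r; have /andP[] := truncn_itv w20.
rewrite ler_nat cardE -(size_map (fun a : 'I_M => (a - a0)%N)) -(size_iota 0 t.+1).
apply: uniq_leq_size.
  rewrite map_inj_in_uniq ?enum_uniq// => x y; rewrite !mem_enum => xA yA /= xy.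
  apply/val_inj; have /= hx := mina x xA; have /= hy := mina y yA; move: xy hx hy.
  by move: (x : nat) (y : nat) (a0 : nat) => *; lia.
move=> _ /mapP[x + ->]; rewrite mem_enum => xA; rewrite mem_iota/= add0n ltnS.
have hx := mina x xA.
rewrite -ltnS -(ltr_nat R) natrB//; apply: lt_trans ht.
move: xA a0A; rewrite !inE !ltr_norml => /andP[? ?] /andP[? ?]; lra.
Qed.

Lemma card_grid_near (M : nat) (c : V) (w : R) : 0 <= w ->
  #|[pred f : {ffun 'I_m -> 'I_M} | [forall k, `|(f k : nat)%:R - c 0 k| < w]]|%:R
    <= (2 * w + 1) ^+ m.
Proof.
move=> w0.
rewrite (_ : #|_| = #|family (fun k : 'I_m => mem [pred a : 'I_M | `|(a : nat)%:R - c 0 k| < w])|); last first.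
  apply: eq_card => f; rewrite !inE; by apply: eq_forallb => k.
rewrite card_family -[in X in _ <= _ ^+ X](card_ord m) cardE /image_mem.
elim: (enum 'I_m) => [|k s IH] //=.
by rewrite natrM exprS ler_pM// card_ord_near.
Qed.

Lemma box_finite_cover (c : nat -> V) (r : nat -> R) :
  (forall x, box x -> exists i, `|x - c i| < r i) ->
  exists j, forall x, box x -> exists2 i, (i < j)%N & `|x - c i| < r i.
Proof.
move=> cov; pose P (j : nat) (x : V) := exists2 i, (i < j)%N & `|x - c i| < r i.
have cbox : compact box.
  apply: bounded_closed_compact.
    by exists 1; split=> // y y3 b /le_trans h; apply: h; exact: ltW.
  apply: (@preimage_closed _ _ (fun a : V => `|a|) [set x : R | x <= 1]); last exact: closed_le.
  by move=> a _; exact: norm_continuous.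
have /compact_near_coveringP/(_ nat \oo P _) := cbox.
case=> [x /cov[i xi]|N _ hN]; last by exists N => x; exact: (hN N (leqnn N)).
have d0 : 0 < r i - `|x - c i| by rewrite subr_gt0.
exists (ball x (r i - `|x - c i|), [set j | (i.+1 <= j)%N]).
  by split; [exact: nbhsx_ballx|exact: nbhs_infty_ge].
move=> [x' j] /= [xx' ij]; exists i => //.
move: xx'; rewrite -ball_normE /= distrC => xx'.
by apply: (le_lt_trans (ler_distD x _ _)); rewrite -ltrBrDr.
Qed.

(** By compactness, finitely many sets suffice.  In a grid finer than all of them,
    a set of radius r contains a proportion at most (5 r)^m of the points. *)
Lemma box_not_null : (0 < m)%N -> ~ null ndist m%:R box.
Proof.
move=> m0 nbox; pose e : R := (2 * 5 ^+ m)^-1.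
have e0 : 0 < e by rewrite invr_gt0 mulr_gt0// exprn_gt0.
have [U [r [boxU r0 dU sumr]]] := nbox e e0.
pose c i := xget 0 (U i).
have Uc i u : U i u -> `|u - c i| <= r i.
  by move=> Uu; apply: (dU i) => //; apply: xgetPex; exists u.
have [|j cov] := @box_finite_cover c (fun i => 2 * r i).
  move=> x /boxU[i _ /Uc h]; exists i; apply: (le_lt_trans h).
  by rewrite ltr_pMl// ltr1n.
(* M exceeds 1 / r i for all i < j. *)
pose M := (\sum_(i < j) (Num.truncn (r i)^-1).+1).+1.
have Mr i : (i < j)%N -> 1 <= r i * M%:R.
  move=> ij; rewrite mulrC -ler_pdivrMr// div1r.
  have /truncn_itv/andP[_ /ltW h] : 0 <= (r i)^-1 by rewrite invr_ge0 ltW.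
  apply: (le_trans h); rewrite ler_nat /M leqW//.
  by rewrite (bigD1 (Ordinal ij))//= leq_addr.
have M0 : 0 < M%:R :> R by rewrite ltr0n.
pose A i := [pred f : {ffun 'I_m -> 'I_M} |
   [forall k, `|(f k : nat)%:R - (M%:R *: c i) 0 k| < 2 * r i * M%:R]].
have cardA i : (i < j)%N -> #|A i|%:R <= 5 ^+ m * M%:R ^+ m * r i `^ m%:R.
  move=> ij; apply: le_trans (card_grid_near _ _ _) _ => //.
    by rewrite !mulr_ge0// ltW.
  rewrite powR_mulrn ?(ltW (r0 i))// -!exprMn; apply: lerXn2r; rewrite ?nnegrE.
  - by rewrite addr_ge0// !mulr_ge0// ltW.
  - by rewrite !mulr_ge0// ltW.
  - by have := Mr i ij; lra.
have covA (f : {ffun 'I_m -> 'I_M}) : (1 <= \sum_(i < j) (f \in A i))%N.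
  pose x : V := \row_k ((f k : nat)%:R / M%:R).
  have [|i ij hi] := cov x.
    apply/rV_norm_leP => // k; rewrite mxE normrM normfV !normr_nat.
    by rewrite ler_pdivrMr// mul1r ler_nat ltnW.
  rewrite (bigD1 (Ordinal ij))//= (_ : f \in A i) ?leq_addr//.
  rewrite inE; apply/forallP => k; rewrite mxE.
  have -> : (f k : nat)%:R - M%:R * c i 0 k = (x - c i) 0 k * M%:R.
    by rewrite !mxE mulrBl divfK ?gt_eqF// (mulrC M%:R).
  by rewrite normrM normr_nat ltr_pM2r// (le_lt_trans (rV_norm_coord _ _)).
have count : (M ^ m <= \sum_(i < j) #|A i|)%N.
  rewrite -[X in (X ^ _)%N](card_ord M) -[X in (_ ^ X)%N](card_ord m) -card_ffun -sum1_card.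
  apply: (@leq_trans (\sum_(f : {ffun 'I_m -> 'I_M}) \sum_(i < j) (f \in A i))).
    by apply: leq_sum => f _; exact: covA.
  rewrite exchange_big /=; apply: leq_sum => i _.
  by rewrite -sum1_card [leqRHS]big_mkcond /=; apply: leq_sum => f _; case: (f \in A i).
have : M%:R ^+ m <= 5 ^+ m * M%:R ^+ m * e.
  rewrite -[leLHS]natrX; apply: (@le_trans _ _ (\sum_(i < j) #|A i|)%:R); first by rewrite ler_nat.
  rewrite natr_sum; apply: (@le_trans _ _ (\sum_(i < j) 5 ^+ m * M%:R ^+ m * r i `^ m%:R)).
    by apply: ler_sum => i _; exact: cardA.
  by rewrite -mulr_sumr; apply: ler_wpM2l; [rewrite mulr_ge0|exact: sumr].
have Mm : 0 < M%:R ^+ m :> R by rewrite exprn_gt0.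
have -> : 5 ^+ m * M%:R ^+ m * e = M%:R ^+ m / 2.
  by rewrite /e; field; rewrite gt_eqF// exprn_gt0.
lra.
Qed.

End Box.

(** * Charts of projective space, and its dimension *)

Lemma nonexpansive_continuous (R : realType) (U W : normedModType R) (f : U -> W) :
  (forall y z, `|f y - f z| <= `|y - z|) -> continuous f.
Proof.
move=> fn y; apply/cvgrPdist_le => e e0; near=> z.
apply: (le_trans (fn _ _)); near: z.
by apply: cvgr_dist_le => //; exact: cvg_id.
Unshelve. all: by end_near. Qed.

Section Charts.
Context {R : realType} {m : nat}.
Local Notation V := 'rV[R]_m.
Local Notation E := 'rV[R]_m.+1.
Local Notation RP := (projective R m.+1).
Notation ndist := (fun x y => `|x - y|).

(** The inverse of the i-th chart: coordinate i is the height t, and the others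
    form x.  Every direction has a slope of norm at most 1 in some chart. *)
Definition insert_coord (i : 'I_m.+1) (u : V * R) : E :=
  \row_j (if unlift i j is Some k then u.1 0 k else u.2).
Definition split_coord (i : 'I_m.+1) (y : E) : V * R := (\row_k y 0 (lift i k), y 0 i).

Lemma insert_coordK i : cancel (insert_coord i) (split_coord i).
Proof.
move=> [x t]; rewrite /split_coord /insert_coord mxE unlift_none /=; congr (_, _).
by apply/rowP => k; rewrite !mxE liftK.
Qed.

Lemma split_coordK i : cancel (split_coord i) (insert_coord i).
Proof.
move=> y; apply/rowP => j; rewrite mxE /=; case: unliftP => [k ->|->] //.
by rewrite mxE.
Qed.

Lemma insert_coordB i u v : insert_coord i (u - v) = insert_coord i u - insert_coord i v.
Proof. by apply/rowP => j; rewrite !mxE; case: unlift => [k|] //=; rewrite !mxE. Qed.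

Lemma insert_coordD i u v : insert_coord i (u + v) = insert_coord i u + insert_coord i v.
Proof. by apply/rowP => j; rewrite !mxE; case: unlift => [k|] //=; rewrite !mxE. Qed.

Lemma insert_coordZ i (c : R) x t : insert_coord i (c *: x, c * t) = c *: insert_coord i (x, t).
Proof. by apply/rowP => j; rewrite !mxE; case: unlift => [k|] //=; rewrite !mxE. Qed.

Lemma insert_coord_norm i u : `|insert_coord i u| = `|u|.
Proof.
apply/eqP; rewrite eq_le; apply/andP; split.
  have /prod_norm_leP[h1 h2] := lexx `|u|.
  apply/rV_norm_leP => // j; rewrite mxE; case: unlift => [k|] //.
  exact: le_trans (rV_norm_coord _ _) h1.
apply/prod_norm_leP; rewrite -{1 3}(insert_coordK i u) /=; split; last exact: rV_norm_coord.
by apply/rV_norm_leP => // k; rewrite mxE rV_norm_coord.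
Qed.

Lemma split_coord_continuous i : continuous (split_coord i).
Proof.
apply: continuous_pair; last exact: coord_continuous.
apply: nonexpansive_continuous => y z.
apply/rV_norm_leP => // k; rewrite !mxE.
by have := rV_norm_coord (y - z) (lift i k); rewrite !mxE.
Qed.

Definition has_slope i (x : V) (L : RP) := `|x| <= 1 /\ insert_coord i (x, 1) \in val L.

Lemma insert_coord_i i u : insert_coord i u 0 i = u.2.
Proof. by rewrite mxE unlift_none. Qed.

Lemma slope_neq0 i (x : V) : insert_coord i (x, 1) != 0.
Proof.
apply/eqP => /rowP/(_ i); rewrite insert_coord_i mxE /= => /eqP.
by rewrite oner_eq0.
Qed.

Lemma slope_norm i (x : V) : `|x| <= 1 -> `|insert_coord i (x, 1)| <= 1.
Proof. by move=> x1; rewrite insert_coord_norm; apply/prod_norm_leP; rewrite /= normr1. Qed.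

Lemma slope_line i x (L : RP) u : has_slope i x L -> u \in val L ->
  exists c, u = c *: insert_coord i (x, 1).
Proof.
move=> [_ xL] uL; have [u0|un0] := eqVneq u 0; first by exists 0; rewrite u0 scale0r.
have LE : <[insert_coord i (x, 1)]>%VS = val L.
  apply/eqP; rewrite eqEdim -memvE xL dim_vline slope_neq0.
  by have /eqP -> := valP L.
by move: uL; rewrite -LE => /vlineP.
Qed.

(** Divide a direction vector by its largest coordinate. *)
Lemma exists_slope (L : RP) : exists i x, has_slope i x L.
Proof.
pose v := vpick (val L).
have vL : v \in val L by exact: memv_pick.
have v0 : v != 0.
  rewrite vpick0; apply/eqP => L0; have /eqP := valP L; by rewrite L0 dimv0.
have [i _ imax] := @arg_maxP _ _ _ (ord0 : 'I_m.+1) xpredT (fun j => `|v 0 j|) isT.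
have vi : v 0 i != 0.
  apply: contra v0 => /eqP vi0; apply/eqP/rowP => j; rewrite mxE; apply/eqP.
  by rewrite -normr_le0 (le_trans (imax j isT))// vi0 normr0.
have vi' : 0 < `|v 0 i| by rewrite normr_gt0.
exists i, (\row_k (v 0 (lift i k) / v 0 i)); split.
  apply/rV_norm_leP => // k; rewrite mxE normrM normfV ler_pdivrMr// mul1r.
  exact: imax.
rewrite (_ : insert_coord _ _ = (v 0 i)^-1 *: v); first exact: memvZ.
apply/rowP => j; rewrite !mxE; case: unliftP => [k ->|->]; rewrite ?mxE 1?mulrC//=.
by rewrite divff.
Qed.

Lemma slope_dir i (x : V) : `|x| <= 1 -> exists L : RP, has_slope i x L.
Proof.
move=> x1; have d : \dim <[insert_coord i (x, 1)]>%VS == 1%N.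
  by rewrite dim_vline slope_neq0.
by exists (exist (fun L : {vspace E} => \dim L == 1%N) _ d); split=> //=; exact: memv_line.
Qed.

Lemma angle_slope i x y (L M : RP) : has_slope i x L -> has_slope i y M ->
  [/\ 0 <= angle L M, `|x - y| <= 2 * m.+1%:R * angle L M &
      angle L M <= 4 * m.+1%:R * `|x - y|].
Proof.
move=> [x1 xL] [y1 yM].
rewrite (angleE xL (slope_neq0 i x) yM (slope_neq0 i y)).
have := @angle_bounds R m.+1 i (insert_coord i (x, 1)) (insert_coord i (y, 1))
  (insert_coord_i _ _) (insert_coord_i _ _) (slope_norm _ x1) (slope_norm _ y1).
rewrite /= -insert_coordB insert_coord_norm.
have -> // : `|(x, 1) - (y, 1) : V * R| = `|x - y|.
rewrite prod_normE /= subrr normr0; exact/max_idPl.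
Qed.

Lemma angle_ge0 (L M : RP) : 0 <= angle L M.
Proof.
have pick0 (N : RP) : vpick (val N) != 0.
  rewrite vpick0; apply/eqP => N0; have /eqP := valP N; by rewrite N0 dimv0.
have npos (N : RP) : 0 < eucl_norm (vpick (val N)).
  by apply: (lt_le_trans _ (norm_le_eucl _)); rewrite normr_gt0.
have nLM := mulr_gt0 (npos L) (npos M).
apply: acos_ge0; apply/andP; split.
  by apply: (@le_trans _ _ 0); [rewrite oppr_le0|rewrite divr_ge0// ltW].
by rewrite ler_pdivrMr// mul1r norm_dot_le.
Qed.

Lemma null_angle s (D : set RP) (A : set V) i : 
  (forall L, D L -> exists2 x, A x & has_slope i x L) ->
  null ndist s A -> null angle s D.
Proof.
move=> DA; apply: (null_rel (rel := fun L x => has_slope i x L) (C := 4 * m.+1%:R)) => //.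
by move=> L M x y _ _ Lx My; have [] := angle_slope Lx My.
Qed.

Lemma not_null_projective : (0 < m)%N -> ~ null (@angle R m.+1) m%:R setT.
Proof.
move=> m0 nT; apply: (@box_not_null R m m0).
apply: (null_rel (rel := has_slope ord0) (C := 2 * m.+1%:R)) nT => //.
  by move=> x x1; have [L] := slope_dir ord0 x1; exists L.
by move=> x y L M _ _ Lx My; have [] := angle_slope Lx My.
Qed.

Lemma hausdorff_dim_projective : hausdorff_dim (@angle R m.+1) setT = m%:R%:E.
Proof.
apply/eqP; rewrite eq_le; apply/andP; split.
  apply: hausdorff_dim_le => // [|s ms]; first exact: angle_ge0.
  have s0 : 0 < s by apply: le_lt_trans ms.
  apply: (@null_sub _ _ _ _ _ (\bigcup_i [set L : RP | exists x, has_slope i x L])).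
    by move=> L _; have [i [x Lx]] := exists_slope L; exists i => //; exists x.
  apply: (@null_bigcup_count _ _ _ _ 'I_m.+1) => // i.
  apply: (null_angle (i := i) _ (null_box ms)) => L [x Lx]; exists x => //.
  by case: Lx.
have [m0|m0] := posnP m; last first.
  by apply: (not_null_le_dim angle_ge0); [rewrite ltr0n|exact: not_null_projective].
have -> : m%:R%:E = 0%E :> \bar R by rewrite m0.
apply: hausdorff_dim_ge0.
have [|L _] := @slope_dir ord0 0; first by rewrite normr0.
by exists L.
Qed.

End Charts.

(** * The critical dimension *)

Section Kakeya.
Context {R : realType} {m : nat}.
Local Notation V := 'rV[R]_m.
Local Notation E := 'rV[R]_m.+1.
Local Notation RP := (projective R m.+1).
Notation ndist := (fun x y => `|x - y|).

(** A set S which is good at exponent s.  Null sets are used instead of a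
    bound on the dimension, to avoid the boundary case. *)
Definition admissible (s : R) := 0 < s /\ exists (D : set RP) (S : set E),
  [/\ hausdorff_dim angle D = m%:R%:E, forall L, D L -> contains_segment S L &
      null eucl_dist s S].

(** A countable family of affine maps, such that every segment contains the image
    of a segment over the heights [0, 1] whose lower end is in the unit ball. *)
Definition magnify (i : 'I_m.+1) (k : nat) (z : int) (w : {ffun 'I_m -> int}) (u : V * R) : E :=
  insert_coord i (k.+1%:R^-1 *: (u.1 + \row_j (w j)%:~R), k.+1%:R^-1 * (u.2 + z%:~R)).

(** The orientation of the segment is chosen so that the height increases. *)
Lemma segment_in_chart (S : set E) (L : RP) i x : has_slope i x L -> contains_segment S L ->
  exists (y : V) (h c : R), 0 < c /\ forall s, 0 <= s <= c ->
    S (insert_coord i (y + s *: x, h + s)).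
Proof.
move=> Lx [a [b [ab abL abS]]]; have [c cE] := slope_line Lx abL.
pose v := insert_coord i (x, 1).
have shiftE p s : insert_coord i ((split_coord i p).1 + s *: x, (split_coord i p).2 + s) = p + s *: v.
  rewrite -[X in _ = X + _](split_coordK i p) /v -insert_coordZ mulr1 -insert_coordD.
  by [].
have c0 : c != 0.
  by apply: contra ab => /eqP c0; rewrite eq_sym -subr_eq0 cE c0 scale0r.
have [cp|cn] : 0 < c \/ c < 0 by apply/orP; rewrite -neq_lt eq_sym.
  exists (split_coord i a).1, (split_coord i a).2, c; split=> // s /andP[s0 sc].
  rewrite shiftE; apply: abS; exists (s / c).
    by rewrite /= divr_ge0 ?ler_pdivrMr ?mul1r// ltW.
  by rewrite cE scalerA divfK.
exists (split_coord i b).1, (split_coord i b).2, (- c); rewrite oppr_gt0; split=> // s /andP[s0 sc].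
rewrite shiftE; apply: abS; exists ((c + s) / c).
  by rewrite /= -(ler_nM2r cn) -[_ <= 1](ler_nM2r cn) mul0r mul1r divfK//; apply/andP; split; lra.
by rewrite cE scalerA divfK// scalerDl -cE addrA [a + _]addrC subrK.
Qed.

Lemma norm_sub_floor (y : V) : `|y - \row_j (Num.floor (y 0 j))%:~R| <= 1.
Proof.
apply/rV_norm_leP => // j; rewrite !mxE ler_norml.
have := floor_itv (y 0 j); rewrite intrD => /andP[f1 f2].
by apply/andP; split; lra.
Qed.

Lemma normalized_segment (S : set E) (L : RP) : contains_segment S L ->
  exists i k z w, exists2 x, has_slope i x L & exists2 a : V, `|a| <= 1 &
    forall t, 0 <= t <= 1 -> S (magnify i k z w (a + t *: x, t)).
Proof.
move=> SL; have [i [x Lx]] := exists_slope L.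
have [y [h [c [c0 hS]]]] := segment_in_chart Lx SL.
pose k := Num.truncn (2 / c); set K : R := k.+1%:R.
have K0 : 0 < K by rewrite ltr0n.
have hK : 2 <= K * c.
  have /truncn_itv/andP[_ /ltW] : 0 <= 2 / c by rewrite divr_ge0// ltW.
  by rewrite ler_pdivrMr.
pose z := Num.ceil (h * K).
have z1 : h * K <= z%:~R by exact: ceil_ge.
have z2 : z%:~R < h * K + 1 by have := ceilB1_lt (h * K); rewrite intrB -/z; lra.
pose y1 : V := K *: (y + (z%:~R / K - h) *: x).
pose w := [ffun j => Num.floor (y1 0 j)].
exists i, k, z, w, x => //; exists (y1 - \row_j (w j)%:~R).
  rewrite (_ : \row_j _ = \row_j (Num.floor (y1 0 j))%:~R); first exact: norm_sub_floor.
  by apply/rowP => j; rewrite [LHS]mxE [RHS]mxE ffunE.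
move=> t /andP[t0 t1]; rewrite /magnify /=.
pose s := (t + z%:~R) / K - h.
rewrite (_ : insert_coord i _ = insert_coord i (y + s *: x, h + s)); last first.
  congr (insert_coord i (_, _)); last by rewrite /s addrCA subrr addr0 mulrC.
  rewrite [X in _ *: X](_ : _ = y1 + t *: x); last by rewrite addrAC subrK.
  rewrite -/K /y1 scalerDr !scalerA mulVf ?gt_eqF// scale1r -addrA -scalerDl.
  by congr (_ + _ *: _); rewrite /s; field; rewrite gt_eqF.
apply: hS; rewrite /s; apply/andP; split.
  by rewrite subr_ge0 ler_pdivlMr//; lra.
by rewrite lerBlDr ler_pdivrMr//; nra.
Qed.

Lemma magnify_expands i k z w (u u' : V * R) :
  `|u - u'| <= k.+1%:R * eucl_dist (magnify i k z w u) (magnify i k z w u').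
Proof.
have K0 : 0 < k.+1%:R :> R by rewrite ltr0n.
rewrite -ler_pdivrMl//; apply: le_trans (norm_le_eucl _).
rewrite /magnify -insert_coordB insert_coord_norm ler_pdivrMl//.
set d := (X in _ * `|X|).
have /prod_norm_leP[/= h1 h2] := lexx `|d|.
have E1 : u.1 - u'.1 = k.+1%:R *: d.1.
  rewrite /d /= -scalerBr scalerA divff ?gt_eqF// scale1r.
  by apply/rowP => j; rewrite !mxE; ring.
have E2 : u.2 - u'.2 = k.+1%:R * d.2.
  by rewrite /d /=; field; rewrite gt_eqF.
apply/prod_norm_leP => /=; rewrite E1 E2 normrZ normrM gtr0_norm// !ler_pM2l//.
Qed.

(** There are countably many magnifications, and dim D > sigma, so for one of them
    the slopes of the normalized segments form a set which is not null at sigma.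
    For m = 0 there is only one slope, and it suffices that D is nonempty. *)
Lemma admissible_thin s0 s : admissible s0 -> s0 < s -> thin_at (m := m) s.
Proof.
move=> [s0_gt0 [D [S [dimD DS nS]]]] s0s.
have [sigma [sg0 sgm] thin] := @thin_tubes R m s0 s s0_gt0 s0s.
pose K := ('I_m.+1 * nat * int * {ffun 'I_m -> int})%type.
pose S1 (p : K) : set (V * R) := magnify p.1.1.1 p.1.1.2 p.1.2 p.2 @^-1` S.
pose X (p : K) := [set x : V | (exists2 L, D L & has_slope p.1.1.1 x L) /\
  exists2 a : V, `|a| <= 1 & forall t, 0 <= t <= 1 -> S1 p (a + t *: x, t)].
pose DX p := [set L : RP | D L /\ exists2 x, X p x & has_slope p.1.1.1 x L].
have DcovX : D `<=` \bigcup_p DX p.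
  move=> L DL; have [i [k [z [w [x Lx hx]]]]] := normalized_segment (DS _ DL).
  exists (i, k, z, w) => //; split=> //; exists x => //=; split=> //.
  by exists L.
(* If all the X p were null at sigma, then so would be D. *)
have [p [x0 Xx0] nX] : exists2 p, X p !=set0 & ((0 < m)%N -> ~ null ndist sigma (X p)).
  have [m0|m0] := posnP m.
    have [D0|/set0P[L /DcovX[p _ [_ [x Xx _]]]]] := eqVneq D set0.
      by move: dimD; rewrite D0 hausdorff_dim_set0.
    by exists p => //; exists x.
  apply: contrapT => nX.
  have nD : null angle sigma D.
    apply: null_sub DcovX _; apply: null_bigcup_count => // p.
    apply: (null_angle (i := p.1.1.1) (A := X p)); first by move=> L [].
    apply: contrapT => nnX; apply: nX; exists p => //.
    by apply/set0P/eqP => X0; apply: nnX; rewrite X0; exact: null_set0.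
  have := @lt_dim_not_null R _ _ angle_ge0 sigma D sg0.
  by rewrite dimD lte_fin sgm// => /(_ isT).
have nS1 : null ndist s0 (S1 p).
  apply: (null_rel (rel := fun u y => y = magnify p.1.1.1 p.1.1.2 p.1.2 p.2 u)
    (C := p.1.1.2.+1%:R)) nS => //.
    by move=> u Su; exists (magnify p.1.1.1 p.1.1.2 p.1.2 p.2 u).
  by move=> u u' y y' _ _ -> ->; exact: magnify_expands.
(* The normalized segments have heights in [0, 1], while the new ones need [- L, L]; f maps
   the heights [- l, l] onto [0, 1]. *)
move=> L L0; pose l := L + 1; have l0 : 0 < l by rewrite /l; lra.
pose c := 2 * l; have c0 : 0 < c by rewrite /c; lra.
pose f (u : V * R) : V * R := (c^-1 *: u.1, c^-1 * (u.2 + l)).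
have nS2 : null ndist s0 (f @^-1` S1 p).
  apply: (null_rel (rel := fun u v => v = f u) (C := c)) nS1 => //.
    by move=> u Su; exists (f u).
  move=> u u' _ _ _ _ -> ->; change (`|u - u'| <= c * `|f u - f u'|); set d := f u - f u'.
  have /prod_norm_leP[/= h1 h2] := lexx `|d|.
  have E1 : u.1 - u'.1 = c *: d.1.
    by rewrite /d /= -scalerBr scalerA divff ?gt_eqF// scale1r.
  have E2 : u.2 - u'.2 = c * d.2 by rewrite /d /=; field; rewrite gt_eqF.
  by apply/prod_norm_leP => /=; rewrite E1 E2 normrZ (normrM c d.2) gtr0_norm// !ler_pM2l.
exists (3 * l) => e e0.
apply: (thin L (3 * l) (f @^-1` S1 p) (X p) L0 _ _ nX nS2) => //.
- by exists x0.
- by move=> x [[L' _ []]].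
move=> x [[L' _ [x1 _]] [a a1 ha]]; exists (c *: a + l *: x).
  rewrite (le_trans (ler_normD _ _))// !normrZ !gtr0_norm// /c.
  have : 2 * l * `|a| <= 2 * l by rewrite ler_piMr// mulr_ge0// ltW.
  have : l * `|x| <= l by rewrite ler_piMr// ltW.
  lra.
move=> t; rewrite ler_norml => /andP[t1 t2]; rewrite /preimage /f /=.
have := ha (c^-1 * (t + l)).
rewrite (_ : a + _ = c^-1 *: (c *: a + l *: x + t *: x)); last first.
  by rewrite -addrA -scalerDl (addrC l) scalerDr !scalerA mulVf ?gt_eqF// scale1r.
apply; apply/andP; split.
  by rewrite mulr_ge0 ?invr_ge0 ?(ltW c0)//; rewrite /l; lra.
by rewrite ler_pdivrMl// /c /l; lra.
Qed.

Lemma eucl_null s (F : set (V * R)) i : null ndist s F ->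
  null eucl_dist s (split_coord i @^-1` F).
Proof.
apply: (null_rel (rel := fun y u => u = split_coord i y) (C := m.+1%:R)) => //.
  by move=> y Fy; exists (split_coord i y).
move=> y y' _ _ _ _ -> ->; apply: (le_trans (eucl_le_norm _)).
rewrite ler_pM2l//.
rewrite -{1}(split_coordK i y) -{1}(split_coordK i y') -insert_coordB.
by rewrite insert_coord_norm.
Qed.

Lemma contains_unit_segmentW (S : set E) L : contains_unit_segment S L -> contains_segment S L.
Proof.
move=> [a [b [ab1 abL abS]]]; exists a, b; split=> //; apply/eqP => ab.
by move: ab1; rewrite ab /eucl_dist subrr -(scale0r b) eucl_normZ normr0 mul0r => /esym/eqP; rewrite oner_eq0.
Qed.

Lemma contains_lineW (S : set E) L : contains_line S L -> contains_segment S L.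
Proof.
move=> [a aS]; have [i [x Lx]] := exists_slope L.
exists a, (a + insert_coord i (x, 1)); have [_ xL] := Lx; split.
- by rewrite -subr_eq0 opprD addrA subrr add0r oppr_eq0 slope_neq0.
- by rewrite addrC addKr.
- by move=> _ [t _ <-]; apply: aS; rewrite /line_through /= addrC addKr memvZ// addrC addKr.
Qed.

Lemma null_space s : m.+1%:R < s -> null eucl_dist s [set: E].
Proof.
move=> ms; have s0 : 0 < s by apply: le_lt_trans ms.
apply: (@null_sub _ _ _ _ _ (\bigcup_(N : nat) [set y : E | `|y| <= N.+1%:R])).
  move=> y _; exists (Num.truncn `|y|) => //=.
  by have /andP[_ /ltW] := truncn_itv (normr_ge0 y).
apply: null_bigcup => N.
apply: (null_rel (rel := fun y u => u = N.+1%:R^-1 *: y) (C := m.+1%:R * N.+1%:R)) (@null_box R m.+1 s ms).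
- by rewrite mulr_gt0.
- move=> y /= yN; exists (N.+1%:R^-1 *: y) => //=.
  by rewrite normrZ ger0_norm ?invr_ge0// ler_pdivrMl// mulr1.
- move=> y y' _ _ _ _ -> ->; apply: (le_trans (eucl_le_norm _)).
  by rewrite -scalerBr normrZ (ger0_norm (_ : 0 <= N.+1%:R^-1)) ?invr_ge0// mulrA mulfK//.
Qed.

End Kakeya.

Theorem theorem1p1 (R : realType) (n : nat) (n_gt0 : (0 < n)%N) :
  exists! d : R, d <= n%:R /\
  [/\ exists K : set 'rV[R]_n,
        [/\ compact K, hausdorff_dim eucl_dist K = d%:E &
            forall L : projective R n, contains_unit_segment K L],
      exists F : set 'rV[R]_n,
        [/\ closed F, hausdorff_dim eucl_dist F = d%:E &
            forall L : projective R n, contains_line F L] &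
      forall (D : set (projective R n)) (S : set 'rV[R]_n),
        hausdorff_dim angle D = (n.-1)%:R%:E ->
        (forall L : projective R n, D L -> contains_segment S L) ->
        (d%:E <= hausdorff_dim eucl_dist S)%E].
Proof.
case: n n_gt0 => [//|m] _ /=.
pose Z := [set s : R | admissible (m := m) s].
have dimT := @hausdorff_dim_projective R m.
have Zbig s : m.+1%:R < s -> Z s.
  move=> ms; split; first by apply: le_lt_trans ms.
  exists setT, setT; split=> //; last exact: null_space.
  by move=> L _; apply: contains_lineW; exists 0.
have Zlb : lbound Z 0 by move=> s [/ltW].
have Z0 : Z !=set0 by exists (m.+1%:R + 1); apply: Zbig; rewrite ltrDl.
have hZ : has_inf Z by split=> //; exists 0.
pose d := inf Z.
have d0 : 0 <= d by exact: lb_le_inf.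
have dn : d <= m.+1%:R.
  rewrite leNgt; apply/negP => /midf_lt[h1 h2].
  have /(ge_inf hZ.2) := Zbig _ h1; rewrite -/d; lra.
have thin s : d < s -> thin_at (m := m) s.
  move=> /(inf_lt Z0)[s0 Zs0 s0s]; exact: admissible_thin s0s.
have [F0 [clF0 nF0 lineF0]] := line_set d0 thin.
pose F := [set y : 'rV[R]_m.+1 | exists2 i, i \in enum 'I_m.+1 & (split_coord i @^-1` F0) y].
have clF : closed F.
  apply: closed_seq_union => i _; apply: preimage_closed clF0 => y _.
  exact: split_coord_continuous.
have nF s : d < s -> null eucl_dist s F.
  move=> ds; have s0 := le_lt_trans d0 ds.
  apply: (@null_sub _ _ _ _ _ (\bigcup_i (split_coord i @^-1` F0))).
    by move=> y [i _ Fy]; exists i.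
  apply: (@null_bigcup_count _ _ _ _ 'I_m.+1) => // i; apply: eucl_null; exact: nF0.
have lineF i x L : has_slope i x L -> exists2 a : 'rV[R]_m.+1, `|a| <= 3 &
    forall t, F (a + t *: insert_coord i (x, 1)).
  move=> [x1 xL]; have [a a3 ha] := lineF0 x x1; exists (insert_coord i (a, 0)).
    by rewrite insert_coord_norm; apply/prod_norm_leP; rewrite /= normr0.
  move=> t; exists i; first by rewrite mem_enum.
  rewrite -insert_coordZ mulr1 -insert_coordD /preimage /= insert_coordK.
  rewrite (_ : _ + _ = (a + t *: x, t)); first exact: ha.
  by congr (_, _); rewrite /= add0r.
(* 4 = 3 + 1: the distance to the origin of a point of the line, plus the length
   of the segment. *)
pose K := F `&` [set y | `|y| <= 4].
have cK : compact K.
  apply: bounded_closed_compact.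
    by exists 4; split=> // y y3 b [_ /le_trans h]; apply: h; exact: ltW.
  apply: closedI => //.
  apply: (@preimage_closed _ _ (fun a : 'rV[R]_m.+1 => `|a|) [set x : R | x <= 4]); last exact: closed_le.
  by move=> a _; exact: norm_continuous.
have unitK L : contains_unit_segment K L.
  have [i [x Lx]] := exists_slope L; have [a a3 ha] := lineF i x L Lx.
  have [x1 xL] := Lx; set v := insert_coord i (x, 1) in ha xL.
  have v1 : 1 <= eucl_norm v.
    apply: le_trans (norm_le_eucl _); rewrite insert_coord_norm.
    by have /prod_norm_leP[_ /=] := lexx `|(x, 1 : R)|; rewrite normr1.
  have v0 : 0 < eucl_norm v by apply: lt_le_trans v1.
  exists a, (a + (eucl_norm v)^-1 *: v); split.
  - rewrite /eucl_dist opprD addrA subrr add0r -scaleNr eucl_normZ normrN gtr0_norm ?invr_gt0//.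
    by rewrite mulVf// gt_eqF.
  - by rewrite addrC addKr memvZ.
  - move=> _ [t /andP[t0 t1] <-]; rewrite addrAC subrr add0r scalerA; split; first exact: ha.
    rewrite /= (le_trans (ler_normD _ _))// (_ : 4 = 3 + 1); last by ring.
    rewrite lerD// normrZ -[leRHS]mulr1 ler_pM//; last by rewrite insert_coord_norm; apply/prod_norm_leP; rewrite /= normr1.
    rewrite ger0_norm ?mulr_ge0 ?invr_ge0 ?(ltW v0)// -[leRHS]mulr1 ler_pM ?invr_ge0 ?(ltW v0)//.
    by rewrite invf_le1.
have lineFL L : contains_line F L.
  have [i [x Lx]] := exists_slope L; have [a a3 ha] := lineF i x L Lx.
  exists a => y yL; have [c cE] := slope_line Lx yL.
  by rewrite -(subrK a y) cE addrC; exact: ha.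
have lower (D : set (projective R m.+1)) (S : set 'rV[R]_m.+1) :
    hausdorff_dim angle D = m%:R%:E ->
    (forall L : projective R m.+1, D L -> contains_segment S L) ->
    (d%:E <= hausdorff_dim eucl_dist S)%E.
  move=> dimD DS.
  (* D is nonempty because its dimension is not -oo; hence S is nonempty, and s
     can be chosen positive. *)
  have [D0|/set0P[L /DS[a [b [_ _ abS]]]]] := eqVneq D set0.
    by move: dimD; rewrite D0 hausdorff_dim_set0.
  have dim0 : (0 <= hausdorff_dim (@eucl_dist R m.+1) S)%E.
    apply: hausdorff_dim_ge0; exists a; apply: abS; exists 0; first by rewrite /= lexx ler01.
    by rewrite scale0r addr0.
  rewrite leNgt; apply/negP => dimS.
  have [s [s0 sd dims]] : exists s, [/\ 0 < s, s < d &
      (hausdorff_dim (@eucl_dist R m.+1) S < s%:E)%E].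
    case: (hausdorff_dim _ S) dim0 dimS => [h| |]//; rewrite lee_fin lte_fin => h0 hd.
    have [h1 h2] := midf_lt hd; exists ((h + d) / 2); split=> //.
    exact: le_lt_trans h1.
  have : Z s.
    split=> //; exists D, S; split=> //.
    exact: (hausdorff_dim_lt_null (@eucl_dist_ge0 R m.+1)).
  by move=> /(ge_inf hZ.2); rewrite leNgt sd.
have dimF (G : set 'rV[R]_m.+1) : G `<=` F -> (forall L, contains_segment G L) ->
    hausdorff_dim eucl_dist G = d%:E.
  move=> GF segG; apply/eqP; rewrite eq_le; apply/andP; split.
    apply: hausdorff_dim_le => // [|s /nF]; first exact: eucl_dist_ge0.
    exact: null_sub.
  by apply: (lower setT) => // L _; exact: segG.
exists d; split.
  split=> //; split=> //.
    exists K; split=> //; apply: dimF; first by move=> y [].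
    by move=> L; apply: contains_unit_segmentW.
  exists F; split=> //; apply: dimF => // L; exact: contains_lineW.
move=> d' [_ [[K' [_ dimK' unitK']] _ lower']].
apply/eqP; rewrite eq_le; apply/andP; split; rewrite -lee_fin.
  rewrite -dimK'; apply: (lower setT) => // L _; exact: contains_unit_segmentW.
rewrite -(dimF K); last 2 first.
- by move=> y [].
- by move=> L; exact: contains_unit_segmentW.
by apply: (lower' setT) => // L _; exact: contains_unit_segmentW.
Qed.
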